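(* Let $a>0$ and $q\in(a\sin\vartheta_0,a)$. There exists $b_0=b_0(a,q)\in(0,q/2)$ such that for all $b\in(0,b_0)$ the mechanical system with parameters $a,b,q$ described in the context has the following properties. (1) The phase of a transition to free motion uniquely determines the phase of the next transition to free motion, and this defines a discontinuous mapping $T$ from $[t_2,t_3)$ into itself. (2) There exist two disjoint segments (nondegenerate compact intervals) $J_0,J_1\subset[t_2,3\pi/2]$ such that $T(J_i)\supset[t_2,3\pi/2]$ and $T$ is continuous on $J_i$ for $i=0,1$. (3) In particular, there exists an infinite set $P$ of periodic points of $T$, and the minimal periods of the points of $P$ are unbounded. (4) There exists a compact subset $J\subset J_0\cup J_1$ with $T(J)\subset J$ such that $T|_J$ is continuously semi-conjugated to the one-sided shift: there is a continuous surjective map $H:J\to\Sigma$ with $H\circ T|_J=S\circ H$.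
   Context: Constant: $\vartheta_0\in[0,\pi/2]$ is the unique number with $\pi-\vartheta_0=\cot(\vartheta_0/2)$ ($\vartheta_0\approx0.81047$, $\sin\vartheta_0\approx0.724611$). Notation (for $a>0$, $0<2b<q<a$): $F(t)=a\sin t+2b$, $c=b-q/2<0$. $t_0<t_1$ are the zeros of $F(t)-q$ on $[0,2\pi]$, i.e. $t_0=\arcsin((q-2b)/a)$, $t_1=\pi-t_0$; $t_2<t_3$ are the zeros of $F$ on $[0,2\pi]$, i.e. $t_2=\pi+\arcsin(2b/a)$, $t_3=2\pi-\arcsin(2b/a)$. The phase of an instant $t$ is $t \bmod 2\pi\in[0,2\pi)$. System: a unit mass at $x(t)$ and a delimiter with dry friction at $y(t)$, with $x\le y$ always and $y$ nondecreasing. Regimes: - free motion: $x<y$, $\ddot x=F(t)$, $\dot y=0$; - progression: $x=y$, $\dot x>0$ (except possibly at the initial instant), $\ddot x=F(t)-q=a\sin t+2c$; - stop: $x=y$, $\dot x=\dot y=0$. Transitions: free motion ends at the first instant when $x=y$ again; if the velocity $\dot x$ is then positive, progression starts at that instant with that initial velocity. Progression ends at the first instant when $\dot x=0$. Whenever $x=y$ and $\dot x=0$ at an instant $\tau$ (end of a progression, or end of a free motion with zero velocity), then: if the phase of $\tau$ is in $[t_2,t_3)$, free motion starts immediately at $\tau$ with $\dot x(\tau)=0$; if the phase is in $[t_1,t_2)$, the mass stays in the stop regime until the next instant of phase $t_2$ and then free motion starts with zero velocity; if the phase is in $[t_3,2\pi)\cup[0,t_0]$, the mass stays at rest until the next instant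 of phase $t_0$ (immediately if the phase is $t_0$) and then progression starts with zero initial velocity. (Such an instant $\tau$ cannot have phase in $(t_0,t_1)$.) Map $T$: for $\theta\in[t_2,t_3)$ start free motion at time $\theta$ with $x(\theta)=y(\theta)=0$, $\dot x(\theta)=\dot y(\theta)=0$. Let $\widehat T(\theta)>\theta$ be the first later instant at which the system switches to free motion (a zero-velocity contact followed immediately by free motion counts as such a switch), and $T(\theta)=\widehat T(\theta)\bmod 2\pi$. Symbolic dynamics: $\Sigma=\{0,1\}^{\mathbb Z_+}$, with $\mathbb Z_+=\{0,1,2,\dots\}$, has the metric $d(\sigma,\varsigma)=\sum_{k\ge0}2^{-k}|\sigma_k-\varsigma_k|$, and $S:\Sigma\to\Sigma$ is the left shift, $(S\sigma)_k=\sigma_{k+1}$. *)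

(* Defs.v *)
From Stdlib Require Export Reals Lra List.
From Coquelicot Require Export Coquelicot.
Open Scope R_scope.

(* The equation PI - th = cot (th/2) on [0, PI/2]; the cotangent is undefined
   at th = 0, hence the strict lower bound. *)
Definition is_vartheta0 (th : R) : Prop :=
  0 < th <= PI / 2 /\ PI - th = cos (th / 2) / sin (th / 2).

Lemma vartheta0_exists_unique : exists! th, is_vartheta0 th.
Proof.
pose (h := fun t => (PI - t) * sin (t / 2) - cos (t / 2)).
pose proof PI_RGT_0 as Hpi; pose proof PI2_1 as Hpi2.
assert (Hd : forall t, is_derive h t
          ((PI - t) / 2 * cos (t / 2) - sin (t / 2) / 2)).
{ intros t; unfold h; auto_derive; [exact I | unfold Rdiv; field]. }
assert (Hder : forall t, 0 < t <= PI / 2 ->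
          0 < (PI - t) / 2 * cos (t / 2) - sin (t / 2) / 2).
{ intros t Ht.
  assert (Hs : sin (t / 2) <= sin (PI / 4)) by (apply sin_incr_1; lra).
  assert (Hc : cos (PI / 4) <= cos (t / 2)) by (apply cos_decr_1; lra).
  rewrite sin_cos_PI4 in Hs.
  assert (0 < cos (PI / 4)) by (apply cos_gt_0; lra).
  nra. }
assert (Hiff : forall t, 0 < t <= PI / 2 ->
          (PI - t = cos (t / 2) / sin (t / 2) <-> h t = 0)).
{ intros t Ht.
  assert (0 < sin (t / 2)) by (apply sin_gt_0; lra).
  unfold h; split; intros E.
  - rewrite E; field; lra.
  - apply (Rmult_eq_reg_r (sin (t / 2))); [|lra].
    replace (cos (t / 2) / sin (t / 2) * sin (t / 2)) with (cos (t / 2))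
      by (field; lra).
    lra. }
assert (Hcont : continuity h).
{ intros t; apply derivable_continuous_pt.
  eexists; apply is_derive_Reals, Hd. }
assert (H0 : h 0 < 0).
{ unfold h; replace (0 / 2) with 0 by field; rewrite sin_0, cos_0; lra. }
assert (H1 : 0 < h (PI / 2)).
{ unfold h; replace (PI / 2 / 2) with (PI / 4) by field.
  rewrite sin_cos_PI4.
  assert (0 < cos (PI / 4)) by (apply cos_gt_0; lra).
  nra. }
destruct (IVT h 0 (PI / 2) Hcont) as [z [Hz Hz0]]; [lra | lra | lra |].
assert (z <> 0) by (intros E; rewrite E in Hz0; lra).
assert (Hmono : forall s t, 0 < s -> s < t -> t <= PI / 2 -> h s < h t).
{ intros s t Hs Hst Ht.
  destruct (MVT_cor2 h (fun t => (PI - t) / 2 * cos (t / 2) - sin (t / 2) / 2)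
              s t Hst) as [c [Ec Hc]].
  - intros u _; apply is_derive_Reals, Hd.
  - assert (Hp := Hder c ltac:(lra)); nra. }
exists z; split.
- split; [lra | apply Hiff; lra].
- intros w [Hw Ew]; apply Hiff in Ew; [|exact Hw].
  destruct (Rtotal_order z w) as [L | [E | L]]; [|exact E|].
  + assert (Hm := Hmono z w ltac:(lra) L ltac:(lra)); lra.
  + assert (Hm := Hmono w z ltac:(lra) L ltac:(lra)); lra.
Qed.

Definition F (a b t : R) : R := a * sin t + 2 * b.

Definition t0 (a b q : R) : R := asin ((q - 2 * b) / a).
Definition t1 (a b q : R) : R := PI - t0 a b q.
Definition t2 (a b : R) : R := PI + asin (2 * b / a).
Definition t3 (a b : R) : R := 2 * PI - asin (2 * b / a).

(* t mod 2 PI, in [0, 2 PI) *)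
Definition phase (t : R) : R := 2 * PI * frac_part (t / (2 * PI)).

(* Position and velocity of the mass, position of the delimiter.  The values
   are only constrained on the time intervals mentioned in the predicates
   below; the velocity is continuous across changes of regime because
   consecutive regimes share their common endpoint. *)
Record trajectory := Trajectory {
  pos : R -> R;
  vel : R -> R;
  delim : R -> R
}.

(* x'' = f(t) on [s, e], written as a first-order system: derivatives inside,
   continuity up to the endpoints. *)
Definition motion (f : R -> R) (w : trajectory) (s e : R) : Prop :=
  continuous_on (fun t => s <= t <= e) (pos w) /\
  continuous_on (fun t => s <= t <= e) (vel w) /\
  forall t, s < t < e ->
    is_derive (pos w) t (vel w t) /\ is_derive (vel w) t (f t).

(* A complete regime of free motion on [s, e]: it starts in contact and e is
   the first later instant of contact. *)
Definition free_motion (a b : R) (w : trajectory) (s e : R) : Prop :=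
  s < e /\
  motion (F a b) w s e /\
  (forall t, s <= t <= e -> delim w t = delim w s) /\
  pos w s = delim w s /\
  (forall t, s < t < e -> pos w t < delim w t) /\
  pos w e = delim w e.

(* A complete regime of progression on [s, e]: e is the first instant after s
   at which the velocity vanishes. *)
Definition progression (a b q : R) (w : trajectory) (s e : R) : Prop :=
  s < e /\
  motion (fun t => F a b t - q) w s e /\
  (forall t, s <= t <= e -> pos w t = delim w t) /\
  (forall t, s < t < e -> 0 < vel w t) /\
  vel w e = 0.

(* s = e is allowed: contact with zero velocity at a single instant. *)
Definition stop (w : trajectory) (s e : R) : Prop :=
  s <= e /\
  forall t, s <= t <= e ->
    pos w t = pos w s /\ delim w t = pos w s /\ vel w t = 0.

Definition next_instant_of_phase (p s e : R) : Prop :=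
  s <= e /\ phase e = p /\ forall t, s <= t < e -> phase t <> p.

(* [rest_to_free a b q w tau e]: in the trajectory w there is contact with zero
   velocity at tau, and e >= tau is the first instant at or after tau at which
   free motion starts. *)
Inductive rest_to_free (a b q : R) (w : trajectory) : R -> R -> Prop :=
| rest_free tau :
    t2 a b <= phase tau < t3 a b ->
    stop w tau tau ->
    rest_to_free a b q w tau tau
| rest_stop tau e :
    t1 a b q <= phase tau < t2 a b ->
    next_instant_of_phase (t2 a b) tau e ->
    stop w tau e ->
    rest_to_free a b q w tau e
| rest_progression tau s tau' e :
    t3 a b <= phase tau < 2 * PI \/ 0 <= phase tau <= t0 a b q ->
    next_instant_of_phase (t0 a b q) tau s ->
    stop w tau s ->
    progression a b q w s tau' ->
    rest_to_free a b q w tau' e ->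
    rest_to_free a b q w tau e.

(* [next_switch a b q p theta theta']: some trajectory starts a free motion at
   the instant theta, at position p with zero velocity, and its first later
   switch to free motion occurs at theta'. *)
Definition next_switch (a b q p theta theta' : R) : Prop :=
  exists (w : trajectory) (tau : R),
    pos w theta = p /\ delim w theta = p /\ vel w theta = 0 /\
    free_motion a b w theta tau /\
    ((vel w tau = 0 /\ rest_to_free a b q w tau theta') \/
     (0 < vel w tau /\
      exists tau', progression a b q w tau tau' /\
                   rest_to_free a b q w tau' theta')).

(* T sends the phase of a switch to free motion to the phase of the next one,
   whatever the instant and the position of the former.  The values of T
   outside [t2, t3) are irrelevant. *)
Definition is_switch_map (a b q : R) (T : R -> R) : Prop :=
  forall p tau, t2 a b <= phase tau < t3 a b ->
    (exists tau', next_switch a b q p tau tau') /\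
    (forall tau', next_switch a b q p tau tau' -> phase tau' = T (phase tau)).

Definition minimal_period (T : R -> R) (n : nat) (p : R) : Prop :=
  (1 <= n)%nat /\ Nat.iter n T p = p /\
  forall m, (1 <= m < n)%nat -> Nat.iter m T p <> p.

Definition infinite_set (P : R -> Prop) : Prop :=
  ~ exists l : list R, forall p, P p -> In p l.

Definition Sigma : Type := nat -> bool.

Definition digit (i : bool) : R := if i then 1 else 0.

Definition dist_Sigma (sigma varsigma : Sigma) : R :=
  Series (fun k => / 2 ^ k * Rabs (digit (sigma k) - digit (varsigma k))).

Definition shift (sigma : Sigma) : Sigma := fun k => sigma (S k).

Definition continuous_to_Sigma (J : R -> Prop) (H : R -> Sigma) : Prop :=
  forall s, J s -> forall eps, 0 < eps -> exists delta, 0 < delta /\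
    forall t, J t -> Rabs (t - s) < delta -> dist_Sigma (H t) (H s) < eps.

(* Main.v *)
From Stdlib Require Import ZArith Lia ClassicalEpsilon FunctionalExtensionality.
Require Import Defs.

(* Divide all forces by a, so that a = 1 and b is small.  A flight started at
   phase th close to PI has mean velocity cos th < 0, which the small drift 2b
   reverses only after a time of order 1/b; lowering th by O(sqrt b) delays the
   contact by several periods.  The instant at which the ensuing progression
   ends is strictly decreasing in th, and as th varies it sweeps, over two
   consecutive periods, all phases in [t2, 3 PI/2]; the switch map is this
   instant modulo 2 PI when its phase lies in [t2, t3), and t2 otherwise.  The
   latter holds because of vartheta0: a progression started at phase t0 with
   zero velocity ends before phase PI.  The two sweeps are two monotone full
   branches of T, hence a horseshoe; between them T avoids (t2, 3 PI/2) but
   takes both values t2 and 3 PI/2, so T cannot be continuous. *)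

(** * Real functions, phases and the constant vartheta0 *)

(** With u the duration of the flight, contact means that u (cos th + b u) equals sin tau - sin th,
    so u = - cos th / b + O(1). As 1 + cos th is quadratic in th - PI, moving th by O(sqrt b)
    changes cos th by O(b) and u by O(1); constants such as 60 make this exceed two periods. At
    contact the drift has contributed a velocity close to 2, hence a total close to 1 - cos tau. The
    obstacle is that a first contact may jump as th varies, so the landing instant is not visibly
    continuous in th. Only order is used: monotonicity comes from comparing two flights, and
    surjectivity from prescribing the landing instant and solving for th in an explicit continuous
    equation. A monotone map onto an interval is continuous, and such full branches are all that the
    symbolic dynamics needs. Since every force depends on time alone, all trajectories are explicit
    antiderivatives, and their uniqueness reduces to the mean value theorem. *)

Lemma cont_eps (f : R -> R) (x : R) :
  continuity_pt f x <->
  forall eps, 0 < eps -> exists d, 0 < d /\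
    forall t, Rabs (t - x) < d -> Rabs (f t - f x) < eps.
Proof.
split; intros H eps He.
- destruct (H eps He) as [d [Hd Hc]]; exists d; split; [exact Hd|].
  intros t Ht; destruct (Req_dec t x) as [->|Hn].
  + rewrite Rminus_diag, Rabs_R0; exact He.
  + apply Hc; repeat split; auto.
- destruct (H eps He) as [d [Hd Hc]]; exists d; split; [exact Hd|].
  intros t [_ Ht]; apply Hc, Ht.
Qed.

Lemma cont_lt (f : R -> R) (x y : R) :
  continuity_pt f x -> f x < y ->
  exists d, 0 < d /\ forall t, Rabs (t - x) < d -> f t < y.
Proof.
intros Hf Hy; destruct (proj1 (cont_eps f x) Hf (y - f x)) as [d [Hd H]]; [lra|].
exists d; split; [exact Hd|]; intros t Ht; specialize (H t Ht).
apply Rabs_def2 in H; lra.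
Qed.

Lemma cont_gt (f : R -> R) (x y : R) :
  continuity_pt f x -> y < f x ->
  exists d, 0 < d /\ forall t, Rabs (t - x) < d -> y < f t.
Proof.
intros Hf Hy; destruct (proj1 (cont_eps f x) Hf (f x - y)) as [d [Hd H]]; [lra|].
exists d; split; [exact Hd|]; intros t Ht; specialize (H t Ht).
apply Rabs_def2 in H; lra.
Qed.

Lemma is_derive_continuity (f f' : R -> R) :
  (forall t, is_derive f t (f' t)) -> continuity f.
Proof.
intros H t; apply derivable_continuous_pt; exists (f' t).
apply is_derive_Reals, H.
Qed.

Lemma mvt (f f' : R -> R) (x y : R) :
  (forall t, is_derive f t (f' t)) -> x < y ->
  exists c, x < c < y /\ f y - f x = f' c * (y - x).
Proof.
intros H Hxy; destruct (MVT_cor2 f f' x y Hxy) as [c [Ec Hc]].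
- intros t _; apply is_derive_Reals, H.
- exists c; auto.
Qed.

(** The zero is the supremum of the points up to which f has stayed negative; the intermediate value
    theorem alone would not give the first one. *)
Lemma first_zero (f : R -> R) (m M : R) :
  continuity f -> m < M -> f m < 0 -> 0 <= f M ->
  exists e, m < e <= M /\ f e = 0 /\ forall t, m <= t < e -> f t < 0.
Proof.
intros Hf HmM Hm HM.
set (A := fun t => m <= t <= M /\ forall r, m <= r <= t -> f r < 0).
assert (HA : A m).
{ split; [lra|]; intros r Hr; replace r with m by lra; exact Hm. }
destruct (completeness A) as [e [He1 He2]].
- exists M; intros t [Ht _]; lra.
- exists m; exact HA.
- assert (Hme : m <= e) by (apply He1; exact HA).
  assert (HeM : e <= M) by (apply He2; intros t [Ht _]; lra).
  assert (Hbelow : forall t, m <= t < e -> f t < 0).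
  { intros t Ht; apply Rnot_le_lt; intros Hc.
    assert (e <= t); [|lra].
    apply He2; intros y [Hy1 Hy2]; apply Rnot_lt_le; intros Hty.
    specialize (Hy2 t ltac:(lra)); lra. }
  assert (Hnneg : 0 <= f e).
  { apply Rnot_lt_le; intros Hneg.
    destruct (cont_lt f e 0 (Hf e) Hneg) as [d [Hd Hdt]].
    destruct (Req_dec e M) as [E|E]; [rewrite E in Hneg; lra|].
    set (y := Rmin M (e + d / 2)).
    assert (Hy : e < y <= M /\ y <= e + d / 2).
    { unfold y; pose proof (Rmin_l M (e + d / 2)); pose proof (Rmin_r M (e + d / 2)).
      repeat split; auto; apply Rmin_glb_lt; lra. }
    assert (y <= e); [|lra].
    apply He1; split; [lra|]; intros r Hr.
    destruct (Rlt_le_dec r e); [apply Hbelow; lra|].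
    apply Hdt; rewrite Rabs_pos_eq; lra. }
  assert (Hme' : m < e).
  { destruct Hme as [|E]; [assumption|]; rewrite <- E in Hnneg; lra. }
  exists e; split; [lra|]; split; [|exact Hbelow].
  destruct (Rle_lt_or_eq_dec _ _ Hnneg) as [Hpos|]; [|auto].
  destruct (cont_gt f e 0 (Hf e) Hpos) as [d [Hd Hdt]].
  set (y := Rmax m (e - d / 2)).
  assert (Hy : m <= y < e /\ e - d / 2 <= y).
  { unfold y; pose proof (Rmax_l m (e - d / 2)); pose proof (Rmax_r m (e - d / 2)).
    repeat split; auto; apply Rmax_lub_lt; lra. }
  specialize (Hbelow y ltac:(lra)).
  specialize (Hdt y); rewrite Rabs_left1 in Hdt by lra.
  specialize (Hdt ltac:(lra)); lra.
Qed.

(** Precomposition with this projection turns continuity on a segment into continuity on the line,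
    the form used for intermediate and mean values. *)
Definition clamp (lo hi x : R) : R := Rmax lo (Rmin hi x).

Lemma clamp_in (lo hi x : R) : lo <= hi -> lo <= clamp lo hi x <= hi.
Proof.
intros H; unfold clamp; split; [apply Rmax_l|].
apply Rmax_lub; [exact H | apply Rmin_l].
Qed.

Lemma clamp_id (lo hi x : R) : lo <= x <= hi -> clamp lo hi x = x.
Proof.
intros H; unfold clamp; rewrite Rmin_right, Rmax_right; lra.
Qed.

Lemma clamp_lip (lo hi x y : R) :
  Rabs (clamp lo hi x - clamp lo hi y) <= Rabs (x - y).
Proof.
unfold clamp, Rmax, Rmin; repeat destruct Rle_dec; unfold Rabs;
  repeat destruct Rcase_abs; lra.
Qed.

Lemma continuous_on_eps (D : R -> Prop) (f : R -> R) :
  continuous_on D f <->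
  forall x, D x -> forall eps, 0 < eps -> exists d, 0 < d /\
    forall t, D t -> Rabs (t - x) < d -> Rabs (f t - f x) < eps.
Proof.
split.
- intros H x Hx eps He.
  assert (HL : locally (f x) (fun y => Rabs (y - f x) < eps)).
  { exists (mkposreal eps He); intros y Hy; exact Hy. }
  destruct (H x Hx _ HL) as [d Hd]; exists d; split; [apply cond_pos|].
  intros t HDt Ht; exact (Hd t Ht HDt).
- intros H x Hx P [eps HP].
  destruct (H x Hx eps (cond_pos eps)) as [d [Hd Hdt]].
  exists (mkposreal d Hd); intros t Ht HDt; apply HP, Hdt; assumption.
Qed.

Lemma continuity_clamp (lo hi : R) (f : R -> R) :
  lo <= hi -> continuous_on (fun t => lo <= t <= hi) f ->
  continuity (fun x => f (clamp lo hi x)).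
Proof.
intros Hle Hf x; apply cont_eps; intros eps He.
destruct (proj1 (continuous_on_eps _ f) Hf _ (clamp_in lo hi x Hle) eps He)
  as [d [Hd H]].
exists d; split; [exact Hd|]; intros t Ht; apply H; [apply clamp_in, Hle|].
eapply Rle_lt_trans; [apply clamp_lip | exact Ht].
Qed.

Lemma continuity_continuous_on (D : R -> Prop) (f : R -> R) :
  continuity f -> continuous_on D f.
Proof.
intros Hf; apply continuous_on_eps; intros x _ eps He.
destruct (proj1 (cont_eps f x) (Hf x) eps He) as [d [Hd H]].
exists d; auto.
Qed.

Lemma continuous_on_ext (D : R -> Prop) (f g : R -> R) :
  (forall x, D x -> f x = g x) -> continuous_on D f -> continuous_on D g.
Proof.
intros E H; apply continuous_on_eps; intros x Hx eps He.
destruct (proj1 (continuous_on_eps D f) H x Hx eps He) as [d [Hd Hc]].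
exists d; split; [exact Hd|]; intros t Ht; rewrite <- !E by assumption; auto.
Qed.

Lemma ivt_on (f : R -> R) (x y v : R) :
  continuous_on (fun t => x <= t <= y) f -> x <= y ->
  (f x - v) * (f y - v) <= 0 -> exists z, x <= z <= y /\ f z = v.
Proof.
intros Hf Hxy Hv.
destruct (IVT_cor (fun t => f (clamp x y t) - v) x y) as [z [Hz Ez]].
- intros t; apply continuity_pt_minus.
  + exact (continuity_clamp x y f Hxy Hf t).
  + apply continuity_pt_const; intros ? ?; reflexivity.
- exact Hxy.
- rewrite !clamp_id by lra; exact Hv.
- exists z; split; [exact Hz|]; rewrite clamp_id in Ez by exact Hz; lra.
Qed.

Lemma is_derive_interior (f g : R -> R) (s e t l : R) :
  (forall x, s <= x <= e -> f x = g x) -> s < t < e ->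
  is_derive f t l -> is_derive g t l.
Proof.
intros E Ht; apply is_derive_ext_loc.
assert (Hp : 0 < Rmin (t - s) (e - t)) by (apply Rmin_glb_lt; lra).
exists (mkposreal _ Hp); intros y Hy.
assert (Hy' : Rabs (y - t) < Rmin (t - s) (e - t)) by exact Hy.
pose proof (Rmin_l (t - s) (e - t)); pose proof (Rmin_r (t - s) (e - t)).
apply Rabs_def2 in Hy'; apply E; lra.
Qed.

(** The difference has zero derivative inside and is continuous up to the endpoints. Applied to the
    velocity and then to the position, this determines a trajectory from its initial data. *)
Lemma antideriv_unique (f g h : R -> R) (s e : R) :
  continuous_on (fun t => s <= t <= e) f ->
  (forall t, s < t < e -> is_derive f t (h t)) ->
  (forall t, is_derive g t (h t)) ->
  forall t, s <= t <= e -> f t - f s = g t - g s.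
Proof.
intros Hf Hd Hg t Ht.
destruct (Req_dec s t) as [->|Hn]; [lra|].
assert (Hse : s <= e) by lra.
destruct (MVT_gen (fun x => f (clamp s e x) - g x) s t (fun _ => 0)) as [c [_ Ec]].
- rewrite Rmin_left, Rmax_right by lra; intros x Hx.
  replace 0 with (minus (h x) (h x)) by (unfold minus, plus, opp; simpl; ring).
  apply (is_derive_minus (V := R_NormedModule)); [|apply Hg].
  apply is_derive_interior with f s e; [|lra | apply Hd; lra].
  intros y Hy; rewrite clamp_id by exact Hy; reflexivity.
- rewrite Rmin_left, Rmax_right by lra; intros x Hx.
  apply continuity_pt_minus.
  + exact (continuity_clamp s e f Hse Hf x).
  + exact (is_derive_continuity g h Hg x).
- rewrite !clamp_id in Ec by lra; lra.
Qed.

(** A monotone function can only be discontinuous by a jump, and a jump would leave values of [c, d]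
    unattained. *)
Lemma decr_onto_continuous (f : R -> R) (l h c d : R) :
  (forall x y, l <= x -> x < y -> y <= h -> f y < f x) ->
  (forall x, l <= x <= h -> c <= f x <= d) ->
  (forall y, c <= y <= d -> exists x, l <= x <= h /\ f x = y) ->
  continuous_on (fun t => l <= t <= h) f.
Proof.
intros Hdecr Hin Honto; apply continuous_on_eps; intros x Hx eps He.
assert (Hfx := Hin x Hx).
assert (HR : exists r, 0 < r /\ forall t, l <= t <= h -> x <= t < x + r ->
                 f x - eps < f t <= f x).
(* A preimage of f x - eps / 2 bounds the neighbourhood on the right; if that value is below c, f
   cannot fall by eps at all and any radius does. *)
{ destruct (Rle_lt_dec c (f x - eps / 2)) as [Hc|Hc].
  - destruct (Honto (f x - eps / 2)) as [y [Hy Ey]]; [lra|].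
    assert (Hxy : x < y).
    { apply Rnot_le_lt; intros [L|E]; [|rewrite E in Ey; lra].
      specialize (Hdecr y x ltac:(lra) L ltac:(lra)); lra. }
    exists (y - x); split; [lra|]; intros t Ht Hxt.
    assert (Hd := Hdecr t y ltac:(lra) ltac:(lra) ltac:(lra)).
    destruct (Req_dec x t) as [->|Hn]; [lra|].
    assert (Hd' := Hdecr x t ltac:(lra) ltac:(lra) ltac:(lra)); lra.
  - exists 1; split; [lra|]; intros t Ht Hxt.
    assert (Hft := Hin t Ht).
    destruct (Req_dec x t) as [->|Hn]; [lra|].
    assert (Hd' := Hdecr x t ltac:(lra) ltac:(lra) ltac:(lra)); lra. }
assert (HL : exists r, 0 < r /\ forall t, l <= t <= h -> x - r < t <= x ->
                 f x <= f t < f x + eps).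
{ destruct (Rle_lt_dec (f x + eps / 2) d) as [Hc|Hc].
  - destruct (Honto (f x + eps / 2)) as [y [Hy Ey]]; [lra|].
    assert (Hxy : y < x).
    { apply Rnot_le_lt; intros [L|E]; [|rewrite <- E in Ey; lra].
      specialize (Hdecr x y ltac:(lra) L ltac:(lra)); lra. }
    exists (x - y); split; [lra|]; intros t Ht Hxt.
    assert (Hd := Hdecr y t ltac:(lra) ltac:(lra) ltac:(lra)).
    destruct (Req_dec x t) as [->|Hn]; [lra|].
    assert (Hd' := Hdecr t x ltac:(lra) ltac:(lra) ltac:(lra)); lra.
  - exists 1; split; [lra|]; intros t Ht Hxt.
    assert (Hft := Hin t Ht).
    destruct (Req_dec x t) as [->|Hn]; [lra|].
    assert (Hd' := Hdecr t x ltac:(lra) ltac:(lra) ltac:(lra)); lra. }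
destruct HR as [r [Hr HR]]; destruct HL as [r' [Hr' HL]].
exists (Rmin r r'); split; [apply Rmin_glb_lt; assumption|].
intros t Ht Hd; pose proof (Rmin_l r r'); pose proof (Rmin_r r r').
apply Rabs_def2 in Hd; apply Rabs_def1.
- destruct (Rle_lt_dec x t);
    [specialize (HR t Ht ltac:(lra)) | specialize (HL t Ht ltac:(lra))]; lra.
- destruct (Rle_lt_dec x t);
    [specialize (HR t Ht ltac:(lra)) | specialize (HL t Ht ltac:(lra))]; lra.
Qed.

Lemma cos_period_Z (x : R) (k : Z) : cos (x + 2 * PI * IZR k) = cos x.
Proof.
destruct k as [|p|p]; [f_equal; lra| |].
- rewrite <- (positive_nat_Z p), <- INR_IZR_INZ.
  rewrite <- (cos_period x (Pos.to_nat p)); f_equal; lra.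
- rewrite <- Pos2Z.opp_pos, <- (positive_nat_Z p), opp_IZR, <- INR_IZR_INZ.
  rewrite <- (cos_period _ (Pos.to_nat p)); f_equal; lra.
Qed.

Lemma sin_period_Z (x : R) (k : Z) : sin (x + 2 * PI * IZR k) = sin x.
Proof.
destruct k as [|p|p]; [f_equal; lra| |].
- rewrite <- (positive_nat_Z p), <- INR_IZR_INZ.
  rewrite <- (sin_period x (Pos.to_nat p)); f_equal; lra.
- rewrite <- Pos2Z.opp_pos, <- (positive_nat_Z p), opp_IZR, <- INR_IZR_INZ.
  rewrite <- (sin_period _ (Pos.to_nat p)); f_equal; lra.
Qed.

Lemma phase_eq (t : R) (k : Z) (p : R) :
  0 <= p < 2 * PI -> t = p + 2 * PI * IZR k -> phase t = p.
Proof.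
intros Hp Et; pose proof PI_RGT_0.
unfold phase.
destruct (Int_part_frac_part_spec (t / (2 * PI)) k (p / (2 * PI))) as [_ E].
- split; [apply Rmult_le_pos; [lra | left; apply Rinv_0_lt_compat; lra]|].
  apply Rmult_lt_reg_r with (2 * PI); [lra|].
  replace (p / (2 * PI) * (2 * PI)) with p by (field; lra); lra.
- rewrite Et; field; lra.
- rewrite <- E; field; lra.
Qed.

Lemma phase_decomp (t : R) :
  exists k, t = phase t + 2 * PI * IZR k /\ 0 <= phase t < 2 * PI.
Proof.
pose proof PI_RGT_0; exists (Int_part (t / (2 * PI))); unfold phase.
destruct (base_fp (t / (2 * PI))) as [H1 H2].
split; [|nra].
assert (E := Rplus_Int_part_frac_part (t / (2 * PI))).
apply (Rmult_eq_compat_l (2 * PI)) in E.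
replace (2 * PI * (t / (2 * PI))) with t in E by (field; lra); lra.
Qed.

Lemma phase_periodic (t : R) (k : Z) : phase (t + 2 * PI * IZR k) = phase t.
Proof.
destruct (phase_decomp t) as [j [Et Hp]].
apply phase_eq with (j + k)%Z; [exact Hp|]; rewrite plus_IZR; lra.
Qed.

Lemma sin_gt_between (A s : R) :
  - (PI / 2) <= A -> A < s < PI - A -> sin A < sin s.
Proof.
intros HA Hs; destruct (Rle_lt_dec s (PI / 2)).
- apply sin_increasing_1; lra.
- rewrite <- (sin_PI_x s); apply sin_increasing_1; lra.
Qed.

(* The maximum of (1 - cos s) / s is attained where tan (s / 2) = s, that is, at
   s = PI - th, and equals sin th. *)
Lemma vartheta0_chord (th s : R) :
  is_vartheta0 th -> 0 <= s <= PI -> 1 - cos s <= sin th * s.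
Proof.
intros [[Hth0 Hth1] Eth] Hs.
pose proof PI_RGT_0.
assert (Hsin : 0 < sin (th / 2)) by (apply sin_gt_0; lra).
assert (E2s : sin th = 2 * sin (th / 2) * cos (th / 2))
  by (rewrite <- sin_2a; f_equal; lra).
assert (E2c : cos th = 2 * cos (th / 2) * cos (th / 2) - 1)
  by (rewrite <- cos_2a_cos; f_equal; lra).
assert (Eend : sin th * (PI - th) - (1 + cos th) = 0)
  by (rewrite Eth, E2s, E2c; field; lra).
pose (f := fun t => sin th * t - (1 - cos t)).
assert (Hd : forall t, is_derive f t (sin th - sin t)).
{ intros t; unfold f; auto_derive; [exact I | ring]. }
assert (Hf0 : f 0 = 0) by (unfold f; rewrite cos_0; lra).
assert (Hfe : f (PI - th) = 0) by (unfold f; rewrite Rtrigo_facts.cos_pi_minus; lra).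
assert (0 <= f s); [|unfold f in *; lra].
(* The derivative sin th - sin changes sign only at th and PI - th, and f vanishes at 0 and at PI -
   th, where it has its minimum. *)
destruct (Rle_lt_dec s th) as [L|L].
- destruct (Req_dec s 0) as [->|]; [lra|].
  destruct (mvt f _ 0 s Hd ltac:(lra)) as [c [Hc Ec]].
  assert (sin c <= sin th) by (apply sin_incr_1; lra); nra.
- destruct (Rlt_le_dec s (PI - th)) as [L'|L'].
  + destruct (mvt f _ s (PI - th) Hd L') as [c [Hc Ec]].
    assert (sin th < sin c) by (apply sin_gt_between; lra); nra.
  + destruct (Req_dec s (PI - th)) as [->|]; [lra|].
    destruct (mvt f _ (PI - th) s Hd ltac:(lra)) as [c [Hc Ec]].
    assert (sin c <= sin th)
      by (rewrite <- (sin_PI_x c); apply sin_incr_1; lra); nra.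
Qed.

(** * Horseshoes of interval maps *)

Lemma closed_set_eps (A : R -> Prop) :
  closed_set A <->
  forall x, ~ A x -> exists d, 0 < d /\ forall t, Rabs (t - x) < d -> ~ A t.
Proof.
split; intros H x Hx.
- destruct (H x Hx) as [d Hd]; exists d; split; [apply cond_pos | exact Hd].
- destruct (H x Hx) as [d [Hd Hc]]; exists (mkposreal d Hd); exact Hc.
Qed.

Lemma closed_segment (l h : R) : closed_set (fun t => l <= t <= h).
Proof. apply compact_P2, compact_P3. Qed.

Lemma closed_preimage_on (l h : R) (f : R -> R) (A : R -> Prop) :
  continuous_on (fun t => l <= t <= h) f -> closed_set A ->
  closed_set (fun t => l <= t <= h /\ A (f t)).
Proof.
intros Hf HA; apply closed_set_eps; intros x Hx.
destruct (excluded_middle_informative (l <= x <= h)) as [Hlh|Hlh].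
- destruct (proj1 (closed_set_eps A) HA (f x)) as [d [Hd H]]; [tauto|].
  destruct (proj1 (continuous_on_eps _ f) Hf x Hlh d Hd) as [d' [Hd' H']].
  exists d'; split; [exact Hd'|]; intros t Ht [Hlt HAt].
  exact (H (f t) (H' t Hlt Ht) HAt).
- destruct (proj1 (closed_set_eps _) (closed_segment l h) x Hlh) as [d [Hd H]].
  exists d; split; [exact Hd|]; intros t Ht [Hlt _]; exact (H t Ht Hlt).
Qed.

Lemma closed_union (A B : R -> Prop) :
  closed_set A -> closed_set B -> closed_set (fun t => A t \/ B t).
Proof.
intros HA HB; apply closed_set_eps; intros x Hx.
destruct (proj1 (closed_set_eps A) HA x) as [d [Hd H]]; [tauto|].
destruct (proj1 (closed_set_eps B) HB x) as [d' [Hd' H']]; [tauto|].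
exists (Rmin d d'); split; [apply Rmin_glb_lt; assumption|].
intros t Ht [C|C]; [apply (H t) | apply (H' t)]; auto;
  eapply Rlt_le_trans; eauto; [apply Rmin_l | apply Rmin_r].
Qed.

Lemma closed_inter (A : nat -> R -> Prop) :
  (forall n, closed_set (A n)) -> closed_set (fun t => forall n, A n t).
Proof.
intros HA; apply closed_set_eps; intros x Hx.
apply not_all_ex_not in Hx; destruct Hx as [n Hn].
destruct (proj1 (closed_set_eps _) (HA n) x Hn) as [d [Hd H]].
exists d; split; [exact Hd|]; intros t Ht C; exact (H t Ht (C n)).
Qed.

Lemma closed_ext (A B : R -> Prop) :
  (forall t, A t <-> B t) -> closed_set A -> closed_set B.
Proof.
intros E HA; apply closed_set_eps; intros x Hx.
destruct (proj1 (closed_set_eps _) HA x) as [d [Hd H]]; [rewrite E; exact Hx|].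
exists d; split; [exact Hd|]; intros t Ht C; apply (H t Ht), E, C.
Qed.

(** Pick a point in each K n: a cluster point of this sequence lies in every K n, since almost all
    terms do and K n is closed. *)
Lemma nested_compact_inter (K : nat -> R -> Prop) :
  Rtopology.compact (K 0%nat) ->
  (forall n, closed_set (K n)) ->
  (forall n t, K (S n) t -> K n t) ->
  (forall n, exists t, K n t) ->
  exists t, forall n, K n t.
Proof.
intros HK0 Hcl Hdecr Hne.
assert (Hmono : forall n m t, (n <= m)%nat -> K m t -> K n t).
{ intros n m t Hnm; induction Hnm; auto. }
destruct (Bolzano_Weierstrass
            (fun n => proj1_sig (constructive_indefinite_description _ (Hne n)))
            _ HK0) as [l Hl].
{ intros n; destruct constructive_indefinite_description as [t Ht]; simpl.
  apply Hmono with n; [lia | exact Ht]. }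
exists l; intros n; apply NNPP; intros Hn.
destruct (proj1 (closed_set_eps _) (Hcl n) l Hn) as [d [Hd H]].
destruct (Hl (disc l (mkposreal d Hd)) n) as [p [Hp Hdp]].
{ exists (mkposreal d Hd); intros y Hy; exact Hy. }
destruct constructive_indefinite_description as [t Ht]; simpl in *.
exact (H t Hdp (Hmono n p t Hp Ht)).
Qed.

(** The terms up to N vanish, and the geometric tail from N + 1 on sums to / 2 ^ N. *)
Lemma dist_Sigma_agree (s s' : Sigma) (N : nat) :
  (forall k, (k <= N)%nat -> s k = s' k) -> dist_Sigma s s' <= / 2 ^ N.
Proof.
intros H; unfold dist_Sigma.
set (a := fun k => / 2 ^ k * Rabs (digit (s k) - digit (s' k))).
assert (Hgeom : forall k, / 2 ^ k = (/ 2) ^ k) by (intros k; apply eq_sym, pow_inv).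
assert (Hp : forall k, 0 < (/ 2) ^ k) by (intros k; apply pow_lt; lra).
assert (Ha : forall k, 0 <= a k <= (/ 2) ^ k).
{ intros k; unfold a; rewrite Hgeom; specialize (Hp k).
  destruct (s k), (s' k); unfold digit;
    rewrite ?Rminus_diag, ?Rminus_0_r, ?Rabs_R0, ?Rabs_R1; try lra.
  rewrite Rabs_left1; lra. }
assert (Hex : ex_series (fun k => (/ 2) ^ k))
  by (apply ex_series_geom; rewrite Rabs_pos_eq; lra).
assert (Hea : ex_series a).
{ apply (ex_series_le (V := R_CompleteNormedModule)) with (fun k => (/ 2) ^ k); [|exact Hex].
  intros k; change (Rabs (a k) <= (/ 2) ^ k); specialize (Ha k).
  rewrite Rabs_pos_eq; lra. }
rewrite (Series_incr_n a (S N)) by (lia || exact Hea); simpl pred.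
rewrite (sum_eq a (fun _ => 0)).
2: { intros k Hk; unfold a; rewrite H by lia.
     rewrite Rminus_diag, Rabs_R0; ring. }
rewrite sum_eq_R0 by reflexivity; rewrite Rplus_0_l.
apply Rle_trans with (Series (fun k => (/ 2) ^ S N * (/ 2) ^ k)).
- apply Series_le.
  + intros k; rewrite <- pow_add; apply Ha.
  + exact (ex_series_scal_l (K := R_AbsRing) _ _ Hex).
- rewrite Series_scal_l, Series_geom by (rewrite Rabs_pos_eq; lra).
  rewrite Hgeom; simpl; lra.
Qed.

(** Monotonicity and surjectivity of each branch are recorded instead of continuity, which follows
    from them. The branch [true] is the left one. *)
Definition horseshoe (T : R -> R) (lo hi : bool -> R) (A B : R) : Prop :=
  (forall i, A <= lo i /\ lo i < hi i /\ hi i <= B) /\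
  hi true < lo false /\
  (forall i x y, lo i <= x -> x < y -> y <= hi i -> T y < T x) /\
  (forall i x, lo i <= x <= hi i -> A <= T x <= B) /\
  (forall i z, A <= z <= B -> exists x, lo i <= x <= hi i /\ T x = z).

Lemma horseshoe_continuous (T : R -> R) (lo hi : bool -> R) (A B : R) (i : bool) :
  horseshoe T lo hi A B -> continuous_on (fun t => lo i <= t <= hi i) T.
Proof.
intros (_ & _ & Hdecr & Hin & Honto).
exact (decr_onto_continuous T _ _ A B (Hdecr i) (Hin i) (Honto i)).
Qed.

(** The inverse of a decreasing bijection is again decreasing and onto, hence continuous. Clamping
    the argument makes it total, so that inverse branches can be composed freely. *)
Lemma horseshoe_inverse (T : R -> R) (lo hi : bool -> R) (A B : R) :
  horseshoe T lo hi A B ->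
  exists g : bool -> R -> R, forall i,
    continuity (g i) /\ (forall z, lo i <= g i z <= hi i) /\
    (forall z, A <= z <= B -> T (g i z) = z).
Proof.
intros (Hseg & _ & Hdecr & Hin & Honto).
assert (HAB : A <= B) by (specialize (Hseg true); lra).
assert (Hc : forall i z, exists x, lo i <= x <= hi i /\ T x = clamp A B z)
  by (intros i z; apply Honto, clamp_in, HAB).
set (g := fun i z => proj1_sig (constructive_indefinite_description _ (Hc i z))).
assert (Hg : forall i z, lo i <= g i z <= hi i /\ T (g i z) = clamp A B z).
{ intros i z; unfold g; destruct constructive_indefinite_description; auto. }
assert (Hinj : forall i x y, lo i <= x <= hi i -> lo i <= y <= hi i ->
                 T x < T y -> y < x).
{ intros i x y Hx Hy Hxy; apply Rnot_le_lt; intros [L|E].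
  - specialize (Hdecr i x y ltac:(lra) L ltac:(lra)); lra.
  - rewrite E in Hxy; lra. }
exists g; intros i; split; [|split].
- assert (Hcont : continuous_on (fun t => A <= t <= B) (g i)).
  { apply decr_onto_continuous with (lo i) (hi i).
    - intros x y Hx Hxy Hy; apply (Hinj i); try apply Hg.
      rewrite !(proj2 (Hg _ _)), !clamp_id; lra.
    - intros x _; apply Hg.
    - intros y Hy; exists (T y); split; [apply (Hin i), Hy|].
      assert (E : T (g i (T y)) = T y)
        by (rewrite (proj2 (Hg _ _)), clamp_id; [reflexivity | apply (Hin i), Hy]).
      destruct (Rtotal_order (g i (T y)) y) as [L|[L|L]]; [|exact L|];
        [specialize (Hdecr i _ _ (proj1 (proj1 (Hg i (T y)))) L ltac:(lra))
        |specialize (Hdecr i _ _ (proj1 Hy) L (proj2 (proj1 (Hg i (T y)))))]; lra. }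
  assert (Hcl := continuity_clamp A B (g i) HAB Hcont).
  (* Both points have the same image under T, which is injective on the segment. *)
  replace (g i) with (fun x => g i (clamp A B x)); [exact Hcl|].
  apply functional_extensionality; intros z.
  assert (E : T (g i (clamp A B z)) = T (g i z)).
  { rewrite !(proj2 (Hg _ _)); apply clamp_id, clamp_in, HAB. }
  destruct (Rtotal_order (g i (clamp A B z)) (g i z)) as [L|[L|L]]; [|exact L|];
    pose proof (proj1 (Hg i z)); pose proof (proj1 (Hg i (clamp A B z)));
    specialize (Hdecr i _ _ ltac:(apply Hg) L ltac:(apply Hg)); lra.
- intros z; apply Hg.
- intros z Hz; rewrite (proj2 (Hg i z)); apply clamp_id, Hz.
Qed.

Lemma minimal_period_unique (T : R -> R) (n m : nat) (p : R) :
  minimal_period T n p -> minimal_period T m p -> n = m.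
Proof.
intros (Hn & En & Mn) (Hm & Em & Mm).
destruct (Nat.lt_total n m) as [L|[L|L]]; [|exact L|].
- elim (Mm n); auto.
- elim (Mn m); auto.
Qed.

(** A point has at most one minimal period, so a finite list of points would bound the periods. *)
Lemma unbounded_periods_infinite (T : R -> R) (P : R -> Prop) :
  (forall N : nat, exists p n, P p /\ minimal_period T n p /\ (N < n)%nat) ->
  infinite_set P.
Proof.
intros H [l Hl].
assert (Hb : exists N, forall p n, In p l -> minimal_period T n p -> (n <= N)%nat).
{ clear Hl H; induction l as [|x l [N HN]].
  - exists 0%nat; intros p n [].
  - destruct (excluded_middle_informative (exists n, minimal_period T n x)) as [[n Hn]|Hno].
    + exists (Nat.max n N); intros p m [<-|Hp] Hm.
      * rewrite (minimal_period_unique T m n x) by assumption; lia.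
      * specialize (HN p m Hp Hm); lia.
    + exists N; intros p m [<-|Hp] Hm; [elim Hno; eauto | eauto]. }
destruct Hb as [N HN]; destruct (H N) as (p & n & Hp & Hn & HNn).
specialize (HN p n (Hl p Hp) Hn); lia.
Qed.

(** The point is a fixed point of the inverse branch [true] composed with n inverse branches
    [false], so its orbit visits the left segment once and then the right one n times. The period is
    minimal because the n intermediate points lie to the right of p. *)
Lemma horseshoe_periodic (T : R -> R) (lo hi : bool -> R) (A B : R) (n : nat) :
  horseshoe T lo hi A B ->
  exists p, lo true <= p <= hi true /\ minimal_period T (S n) p.
Proof.
intros Hh; destruct (horseshoe_inverse T lo hi A B Hh) as [g Hg].
destruct Hh as (Hseg & Hord & _).
pose (G := fun m x => Nat.iter m (g false) x).
assert (HGc : forall m, continuity (G m)).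
{ induction m; unfold G; simpl.
  - exact (derivable_continuous _ derivable_id).
  - exact (continuity_comp _ _ IHm (proj1 (Hg false))). }
assert (Hgc : continuity (fun x => g true (G n x)))
  by exact (continuity_comp _ _ (HGc n) (proj1 (Hg true))).
destruct (IVT_cor (fun x => g true (G n x) - x) A B) as [p [Hp Ep]].
- exact (continuity_minus _ _ Hgc (derivable_continuous _ derivable_id)).
- specialize (Hseg true); lra.
- pose proof (proj1 (proj2 (Hg true)) (G n A)).
  pose proof (proj1 (proj2 (Hg true)) (G n B)).
  specialize (Hseg true); simpl; nra.
- assert (Efix : g true (G n p) = p) by (simpl in Ep; lra).
  assert (HpJ : lo true <= p <= hi true) by (rewrite <- Efix; apply Hg).
  assert (HG : forall m, A <= G m p <= B).
  { intros [|m]; [exact Hp|]; unfold G; simpl.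
    pose proof (proj1 (proj2 (Hg false)) (Nat.iter m (g false) p)).
    specialize (Hseg false); lra. }
  assert (Hit : forall j, (j <= n)%nat -> Nat.iter (S j) T p = G (n - j)%nat p).
  { induction j; intros Hj.
    - simpl; rewrite <- Efix at 1; rewrite Nat.sub_0_r; apply Hg, HG.
    - change (T (Nat.iter (S j) T p) = G (n - S j)%nat p).
      rewrite IHj by lia; replace (n - j)%nat with (S (n - S j)) by lia.
      apply Hg, HG. }
  exists p; split; [exact HpJ|]; split; [lia|]; split.
  + rewrite Hit by lia; rewrite Nat.sub_diag; reflexivity.
  + intros m Hm E; destruct m; [lia|].
    rewrite Hit in E by lia.
    replace (n - m)%nat with (S (n - S m)) in E by lia.
    pose proof (proj1 (proj2 (Hg false)) (G (n - S m)%nat p)).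
    change (g false (G (n - S m)%nat p) = p) in E; lra.
Qed.

(** The points whose itinerary begins with the first n digits of sigma. Recursion through T t makes
    a cylinder the preimage of a shorter one under a single continuous branch. *)
Fixpoint cylinder (T : R -> R) (lo hi : bool -> R) (n : nat) (sigma : Sigma)
  (t : R) : Prop :=
  match n with
  | O => True
  | S n => lo (sigma O) <= t <= hi (sigma O) /\
           cylinder T lo hi n (shift sigma) (T t)
  end.

Lemma cylinder_closed (T : R -> R) (lo hi : bool -> R) :
  (forall i, continuous_on (fun t => lo i <= t <= hi i) T) ->
  forall n sigma, closed_set (cylinder T lo hi n sigma).
Proof.
intros HT n; induction n; intros sigma; simpl.
- intros x Hx; elim Hx; exact I.
- apply closed_preimage_on; auto.
Qed.

Lemma cylinder_decr (T : R -> R) (lo hi : bool -> R) (n : nat) :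
  forall sigma t, cylinder T lo hi (S n) sigma t -> cylinder T lo hi n sigma t.
Proof.
induction n; intros sigma t; simpl; [auto|].
intros [H1 H2]; split; [exact H1|]; apply IHn, H2.
Qed.

Lemma horseshoe_cylinder_nonempty (T : R -> R) (lo hi : bool -> R) (A B : R) (n : nat) :
  horseshoe T lo hi A B ->
  forall sigma, exists t, A <= t <= B /\ cylinder T lo hi n sigma t.
Proof.
intros (Hseg & _ & _ & _ & Honto); induction n; intros sigma.
- exists A; split; [specialize (Hseg true); lra | exact I].
- destruct (IHn (shift sigma)) as [z [Hz Hc]].
  destruct (Honto (sigma O) z Hz) as [t [Ht Et]].
  exists t; split; [specialize (Hseg (sigma O)); lra|].
  simpl; rewrite Et; auto.
Qed.

Fixpoint survivors (T : R -> R) (lo hi : bool -> R) (n : nat) (t : R) : Prop :=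
  match n with
  | O => True
  | S n => exists i, lo i <= t <= hi i /\ survivors T lo hi n (T t)
  end.

Lemma survivors_closed (T : R -> R) (lo hi : bool -> R) :
  (forall i, continuous_on (fun t => lo i <= t <= hi i) T) ->
  forall n, closed_set (survivors T lo hi n).
Proof.
intros HT n; induction n; simpl.
- intros x Hx; elim Hx; exact I.
- apply closed_ext with
    (fun t => (lo true <= t <= hi true /\ survivors T lo hi n (T t)) \/
              (lo false <= t <= hi false /\ survivors T lo hi n (T t))).
  + intros t; split; [intros [H|H]; eauto | intros [[|] H]; auto].
  + apply closed_union; apply closed_preimage_on; auto.
Qed.

(** J consists of the points whose whole orbit stays in the two segments, and H reads the itinerary
    by comparing each iterate with the middle M of the gap. Each sequence is realised in a nested
    intersection of compact cylinders. No expansion is assumed, so several points may share an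
    itinerary. *)
Lemma horseshoe_semiconjugate (T : R -> R) (lo hi : bool -> R) (A B : R) :
  horseshoe T lo hi A B ->
  exists J : R -> Prop,
    Rtopology.compact J /\
    (forall t, J t -> exists i, lo i <= t <= hi i) /\
    (forall t, J t -> J (T t)) /\
    exists H : R -> Sigma,
      continuous_to_Sigma J H /\
      (forall sigma, exists t, J t /\ H t = sigma) /\
      (forall t, J t -> H (T t) = shift (H t)).
Proof.
intros Hh.
assert (HTc : forall i, continuous_on (fun t => lo i <= t <= hi i) T)
  by (intros i; apply (horseshoe_continuous T lo hi A B i Hh)).
pose proof Hh as (Hseg & Hord & _).
pose (J := fun t => forall n, survivors T lo hi n t).
assert (HJin : forall t, J t -> exists i, lo i <= t <= hi i).
{ intros t Ht; destruct (Ht 1%nat) as [i [Hi _]]; eauto. }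
assert (HJT : forall t, J t -> J (T t)).
{ intros t Ht n; destruct (Ht (S n)) as [i [_ Hn]]; exact Hn. }
pose (M := (hi true + lo false) / 2).
assert (HM : forall i t, lo i <= t <= hi i -> if i then t < M else M < t).
{ unfold M; pose proof (Hseg true); pose proof (Hseg false).
  intros [|] t Ht; lra. }
(* Points of J closer than the width of the gap lie in the same segment. Hence T is continuous on J,
   and each digit of the itinerary is locally constant there. *)
assert (Hgap : forall t, J t -> forall s, J s -> Rabs (t - s) < lo false - hi true ->
                 (t < M <-> s < M) /\
                 forall i, lo i <= s <= hi i -> lo i <= t <= hi i).
{ intros t Ht s Hs Hd; destruct (HJin t Ht) as [i Hi], (HJin s Hs) as [j Hj].
  pose proof (HM i t Hi); pose proof (HM j s Hj).
  apply Rabs_def2 in Hd.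
  destruct i, j; split; try lra; intros [|] Hk; try lra;
    pose proof (Hseg true); pose proof (Hseg false); lra. }
assert (HTJ : continuous_on J T).
{ apply continuous_on_eps; intros s Hs eps He.
  destruct (HJin s Hs) as [i Hi].
  destruct (proj1 (continuous_on_eps _ T) (HTc i) s Hi eps He) as [d [Hd H]].
  exists (Rmin d (lo false - hi true)); split; [apply Rmin_glb_lt; lra|].
  pose proof (Rmin_l d (lo false - hi true)).
  pose proof (Rmin_r d (lo false - hi true)).
  intros t Ht Hts; apply H; [|lra].
  apply (Hgap t Ht s Hs); [lra | exact Hi]. }
assert (HitJ : forall k t, J t -> J (Nat.iter k T t)).
{ induction k; intros t Ht; simpl; auto. }
assert (Hitc : forall k, continuous_on J (fun t => Nat.iter k T t)).
{ induction k; apply continuous_on_eps; intros s Hs eps He; simpl.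
  - exists eps; auto.
  - destruct (proj1 (continuous_on_eps _ T) HTJ _ (HitJ k s Hs) eps He) as [d [Hd H]].
    destruct (proj1 (continuous_on_eps _ _) IHk s Hs d Hd) as [d' [Hd' H']].
    exists d'; auto. }
pose (H := fun t k => if Rlt_dec (Nat.iter k T t) M then true else false).
exists J; split; [|split; [exact HJin|split; [exact HJT|exists H; repeat split]]].
- apply compact_P5; [apply closed_inter, survivors_closed, HTc|].
  exists A, B; intros t Ht; destruct (HJin t Ht) as [i Hi].
  specialize (Hseg i); lra.
- intros s Hs eps He.
  destruct (pow_lt_1_zero (/ 2) ltac:(rewrite Rabs_pos_eq; lra) eps He) as [N HN].
  assert (HD : exists d, 0 < d /\ forall t, J t -> Rabs (t - s) < d ->
                 forall k, (k <= N)%nat -> H t k = H s k).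
  { clear HN; induction N as [|N [d [Hd IH]]].
    - exists (lo false - hi true); split; [lra|]; intros t Ht Hd k Hk.
      replace k with 0%nat by lia; unfold H; simpl.
      destruct (Hgap t Ht s Hs Hd) as [E _].
      destruct Rlt_dec, Rlt_dec; tauto.
    - destruct (proj1 (continuous_on_eps _ _) (Hitc (S N)) s Hs (lo false - hi true)
                  ltac:(lra)) as [d' [Hd' H']].
      exists (Rmin d d'); split; [apply Rmin_glb_lt; assumption|].
      pose proof (Rmin_l d d'); pose proof (Rmin_r d d').
      intros t Ht Hts k Hk; destruct (Nat.eq_dec k (S N)) as [->|].
      + destruct (Hgap _ (HitJ (S N) t Ht) _ (HitJ (S N) s Hs)) as [E _];
          [apply H'; [exact Ht | lra]|].
        unfold H; destruct Rlt_dec, Rlt_dec; tauto.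
      + apply IH; [exact Ht | lra | lia]. }
  destruct HD as [d [Hd HD]]; exists d; split; [exact Hd|]; intros t Ht Hts.
  apply Rle_lt_trans with (/ 2 ^ N); [apply dist_Sigma_agree; auto|].
  specialize (HN N (le_n N)); rewrite pow_inv in HN.
  apply Rabs_def2 in HN; lra.
- intros sigma.
  (* Lengths start at one: the cylinder of length zero is the whole line and not compact. *)
  destruct (nested_compact_inter (fun n => cylinder T lo hi (S n) sigma)) as [t Ht].
  + apply compact_P5; [apply cylinder_closed, HTc|].
    exists (lo (sigma O)), (hi (sigma O)); intros t [Ht _]; exact Ht.
  + intros n; apply cylinder_closed, HTc.
  + intros n t; apply cylinder_decr.
  + intros n; destruct (horseshoe_cylinder_nonempty T lo hi A B (S n) Hh sigma)
      as [t [_ Ht]]; eauto.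
  + assert (Hsurv : forall n s u, cylinder T lo hi n s u -> survivors T lo hi n u).
    { induction n; intros s u; simpl; [auto|]; intros [H1 H2]; eauto. }
    exists t; split; [intros n; apply Hsurv with sigma, cylinder_decr, Ht|].
    apply functional_extensionality; intros k.
    assert (Hk : forall k n s u, cylinder T lo hi (k + n) s u ->
              cylinder T lo hi n (fun j => s (k + j)%nat) (Nat.iter k T u)).
    { clear; induction k; intros n s u; simpl; [auto|].
      intros [_ Hc]; apply IHk in Hc; unfold shift in Hc.
      rewrite <- Nat.iter_succ_r in Hc; exact Hc. }
    assert (Hc : cylinder T lo hi (k + 1) sigma t)
      by (rewrite Nat.add_1_r; apply Ht).
    apply Hk in Hc; destruct Hc as [Hc _]; rewrite Nat.add_0_r in Hc.
    apply HM in Hc; unfold H.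
    destruct (sigma k); destruct Rlt_dec; reflexivity || lra.
- intros t Ht; apply functional_extensionality; intros k.
  unfold H, shift; rewrite Nat.iter_succ_r; reflexivity.
Qed.

(** * Flight and landing instants for a = 1 *)

(** The force sin t + 2 b integrated twice from zero data at th: the position relative to the
    delimiter during a flight. The formula makes sense for all t, in particular past the contact. *)
Definition gap (b th t : R) : R :=
  cos th * (t - th) - (sin t - sin th) + b * (t - th) ^ 2.

Definition speed (b th t : R) : R := cos th - cos t + 2 * b * (t - th).

Lemma gap_derive (b th t : R) : is_derive (gap b th) t (speed b th t).
Proof. unfold gap, speed; auto_derive; [exact I | ring]. Qed.

Lemma speed_derive (b th t : R) : is_derive (speed b th) t (sin t + 2 * b).
Proof. unfold speed; auto_derive; [exact I | ring]. Qed.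

Lemma gap_periodic (b th t : R) (k : Z) :
  gap b (th + 2 * PI * IZR k) (t + 2 * PI * IZR k) = gap b th t.
Proof. unfold gap; rewrite cos_period_Z, !sin_period_Z; ring. Qed.

Lemma speed_periodic (b th t : R) (k : Z) :
  speed b (th + 2 * PI * IZR k) (t + 2 * PI * IZR k) = speed b th t.
Proof. unfold speed; rewrite !cos_period_Z; ring. Qed.

Definition first_contact (b th tau : R) : Prop :=
  th < tau /\ gap b th tau = 0 /\ forall t, th < t < tau -> gap b th t < 0.

(* During the progression that starts at tau the velocity is
   speed b th t - q (t - tau); e = tau encodes a contact with zero velocity. *)
Definition first_rest (b q th tau e : R) : Prop :=
  tau <= e /\ speed b th e = q * (e - tau) /\
  forall t, tau <= t < e -> q * (t - tau) < speed b th t.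

Definition landing (b q th e : R) : Prop :=
  exists tau, first_contact b th tau /\ first_rest b q th tau e.

(** The chord inequality is the form in which the bound by vartheta0 is used. At s = PI - x it says
    that a progression with zero velocity at phase x would have negative velocity at phase PI. *)
Definition admissible (b q : R) : Prop :=
  0 < b /\ 0 < q - 2 * b /\ q < 1 /\
  forall s, 0 < s <= PI -> 1 - cos s < (q - 2 * b) * s.

Lemma vartheta0_admissible (th b q : R) :
  is_vartheta0 th -> 0 < b -> sin th < q - 2 * b -> q < 1 -> admissible b q.
Proof.
intros Hth Hb Hq Hq1; pose proof PI_RGT_0.
assert (0 < sin th) by (apply sin_gt_0; destruct Hth; lra).
repeat split; try lra; intros s Hs.
assert (Hc := vartheta0_chord th s Hth ltac:(lra)); nra.
Qed.

Lemma t2_t3_bounds (b : R) :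
  0 < b -> 2 * b < 1 ->
  PI < t2 1 b < 3 * PI / 2 /\ t3 1 b = 3 * PI - t2 1 b /\
  sin (t2 1 b) = - (2 * b).
Proof.
intros Hb Hb1; pose proof PI_RGT_0; unfold t2, t3.
replace (2 * b / 1) with (2 * b) by field.
assert (Hs := sin_asin (2 * b) ltac:(lra)).
assert (Hbd := asin_bound_lt (2 * b) ltac:(lra)).
assert (0 < asin (2 * b)).
{ apply Rnot_le_lt; intros C.
  assert (sin (asin (2 * b)) <= sin 0) by (apply sin_incr_1; lra).
  rewrite sin_0 in *; lra. }
repeat split; try lra.
rewrite Rplus_comm, neg_sin; lra.
Qed.

Lemma force_neg (b t : R) :
  0 < b -> 2 * b < 1 -> t2 1 b < t < t3 1 b -> sin t + 2 * b < 0.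
Proof.
intros Hb Hb1 Ht.
destruct (t2_t3_bounds b Hb Hb1) as (H2 & H3 & Hs).
replace t with ((t - PI) + PI) by ring; rewrite neg_sin.
replace (t2 1 b) with ((t2 1 b - PI) + PI) in Hs by ring; rewrite neg_sin in Hs.
assert (sin (t2 1 b - PI) < sin (t - PI)) by (apply sin_gt_between; lra).
lra.
Qed.

(** The force is negative between t2 and t3, so velocity and position both fall from zero; no
    contact can occur before t3. *)
Lemma speed_gap_neg (b th t : R) :
  0 < b -> 2 * b < 1 -> t2 1 b <= th -> th < t <= t3 1 b ->
  speed b th t < 0 /\ gap b th t < 0.
Proof.
intros Hb Hb1 Hth Ht.
assert (Hv : forall r, th < r <= t3 1 b -> speed b th r < 0).
{ intros r Hr; destruct (mvt _ _ th r (speed_derive b th) ltac:(lra)) as [c [Hc Ec]].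
  assert (Hf := force_neg b c Hb Hb1 ltac:(lra)).
  replace (speed b th th) with 0 in Ec by (unfold speed; ring); nra. }
split; [apply Hv, Ht|].
destruct (mvt _ _ th t (gap_derive b th) ltac:(lra)) as [c [Hc Ec]].
specialize (Hv c ltac:(lra)).
replace (gap b th th) with 0 in Ec by (unfold gap; ring); nra.
Qed.

Lemma contact_exists (b th : R) :
  0 < b -> 2 * b < 1 -> t2 1 b <= th < t3 1 b -> exists tau, first_contact b th tau.
Proof.
intros Hb Hb1 Hth; pose proof PI_4.
destruct (t2_t3_bounds b Hb Hb1) as (H2 & H3 & _).
assert (Hib : 2 < / b).
{ apply Rmult_lt_reg_r with b; [lra|]; rewrite Rinv_l; lra. }
assert (Hbb : b * / b = 1) by (apply Rinv_r; lra).
(* The search starts at t3 because the gap also vanishes at th. After a time u = 2 / b + 2 the drift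
   b u^2 = 4 / b + 8 + 4 b exceeds u + 2, which bounds the other terms. *)
destruct (first_zero (gap b th) (t3 1 b) (th + 2 * / b + 2)) as [e (He & Ee & Hlt)].
- exact (is_derive_continuity _ _ (gap_derive b th)).
- lra.
- apply speed_gap_neg; lra.
- unfold gap; pose proof (COS_bound th); pose proof (SIN_bound th).
  pose proof (SIN_bound (th + 2 * / b + 2)).
  replace (th + 2 * / b + 2 - th) with (2 * / b + 2) by ring.
  replace (b * (2 * / b + 2) ^ 2) with (4 * (b * / b) * / b + 8 * (b * / b) + 4 * b) by ring.
  rewrite Hbb; nra.
- exists e; split; [lra|]; split; [exact Ee|]; intros t Ht.
  destruct (Rle_lt_dec t (t3 1 b)); [apply speed_gap_neg; lra | apply Hlt; lra].
Qed.

Lemma contact_unique (b th tau tau' : R) :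
  first_contact b th tau -> first_contact b th tau' -> tau = tau'.
Proof.
intros (H1 & E1 & L1) (H2 & E2 & L2).
destruct (Rtotal_order tau tau') as [L|[L|L]]; [|exact L|].
- specialize (L2 tau ltac:(lra)); lra.
- specialize (L1 tau' ltac:(lra)); lra.
Qed.

Lemma rest_unique (b q th tau e e' : R) :
  first_rest b q th tau e -> first_rest b q th tau e' -> e = e'.
Proof.
intros (H1 & E1 & L1) (H2 & E2 & L2).
destruct (Rtotal_order e e') as [L|[L|L]]; [|exact L|].
- specialize (L2 e ltac:(lra)); lra.
- specialize (L1 e' ltac:(lra)); lra.
Qed.

Lemma landing_unique (b q th e e' : R) :
  landing b q th e -> landing b q th e' -> e = e'.
Proof.
intros (tau & Hc & Hr) (tau' & Hc' & Hr').
rewrite (contact_unique b th tau' tau) in Hr' by assumption.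
exact (rest_unique b q th tau e e' Hr Hr').
Qed.

Lemma landing_periodic (b q th e : R) (k : Z) :
  landing b q th e -> landing b q (th + 2 * PI * IZR k) (e + 2 * PI * IZR k).
Proof.
set (P := 2 * PI * IZR k).
assert (Hg : forall t, gap b (th + P) t = gap b th (t - P)).
{ intros t; unfold P; rewrite <- (gap_periodic b th (t - 2 * PI * IZR k) k).
  f_equal; ring. }
assert (Hv : forall t, speed b (th + P) t = speed b th (t - P)).
{ intros t; unfold P; rewrite <- (speed_periodic b th (t - 2 * PI * IZR k) k).
  f_equal; ring. }
intros (tau & (H1 & E1 & L1) & H2 & E2 & L2); exists (tau + P); split.
- split; [lra|]; split.
  + rewrite Hg; replace (tau + P - P) with tau by ring; exact E1.
  + intros t Ht; rewrite Hg; apply L1; lra.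
- split; [lra|]; split.
  + rewrite Hv; replace (e + P - P) with e by ring; rewrite E2; ring.
  + intros t Ht; rewrite Hv; replace (t - (tau + P)) with (t - P - tau) by ring.
    apply L2; lra.
Qed.

Lemma contact_speed_nonneg (b th tau : R) :
  first_contact b th tau -> 0 <= speed b th tau.
Proof.
intros (H & E & L); apply Rnot_lt_le; intros Hneg.
destruct (cont_lt (speed b th) tau 0) as [d [Hd Hdt]]; [|exact Hneg|].
{ exact (is_derive_continuity _ _ (speed_derive b th) tau). }
set (y := Rmax ((th + tau) / 2) (tau - d / 2)).
pose proof (Rmax_l ((th + tau) / 2) (tau - d / 2)).
pose proof (Rmax_r ((th + tau) / 2) (tau - d / 2)).
assert (y < tau) by (apply Rmax_lub_lt; lra).
destruct (mvt _ _ y tau (gap_derive b th) ltac:(assumption)) as [c [Hc Ec]].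
assert (Hcneg : speed b th c < 0).
{ apply Hdt; rewrite Rabs_left1 by lra; unfold y in *; lra. }
specialize (L y ltac:(unfold y in *; lra)); nra.
Qed.

(** Under a positive force the velocity, zero at tau, would be negative just before, and the gap,
    also zero at tau, would be positive there. *)
Lemma tangency_force (b th tau : R) :
  first_contact b th tau -> speed b th tau = 0 -> sin tau + 2 * b <= 0.
Proof.
intros (H & E & L) Hv; apply Rnot_lt_le; intros Hpos.
destruct (cont_gt sin tau (- (2 * b))) as [d [Hd Hdt]];
  [exact (continuity_sin tau) | lra |].
set (y := Rmax ((th + tau) / 2) (tau - d / 2)).
pose proof (Rmax_l ((th + tau) / 2) (tau - d / 2)).
pose proof (Rmax_r ((th + tau) / 2) (tau - d / 2)).
assert (y < tau) by (apply Rmax_lub_lt; lra).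
assert (Hvneg : forall r, y <= r < tau -> speed b th r < 0).
{ intros r Hr; destruct (mvt _ _ r tau (speed_derive b th) ltac:(lra)) as [c [Hc Ec]].
  assert (- (2 * b) < sin c).
  { apply Hdt; rewrite Rabs_left1 by lra; unfold y in *; lra. }
  nra. }
destruct (mvt _ _ y tau (gap_derive b th) ltac:(assumption)) as [c [Hc Ec]].
specialize (Hvneg c ltac:(lra)); specialize (L y ltac:(unfold y in *; lra)); nra.
Qed.

Lemma rest_exists (b q th tau : R) :
  0 < b -> 0 < q - 2 * b -> th < tau -> 0 <= speed b th tau ->
  exists e, first_rest b q th tau e.
Proof.
intros Hb Hq Hth [Hv|Hv].
(* By M the mean deceleration q - 2 b has consumed the drift velocity 2 b (tau - th) gained in
   flight and the oscillating part, which is at most 2. *)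
- set (M := tau + (2 * b * (tau - th) + 2) / (q - 2 * b) + 1).
  assert (HM : (M - tau) * (q - 2 * b) = 2 * b * (tau - th) + 2 + (q - 2 * b))
    by (unfold M; field; lra).
  assert (tau < M) by nra.
  destruct (first_zero (fun t => q * (t - tau) - speed b th t) tau M)
    as [e (He & Ee & Hlt)].
  + apply (is_derive_continuity _ (fun t => q - (sin t + 2 * b))).
    intros t; unfold speed; auto_derive; [exact I | ring].
  + assumption.
  + lra.
  + unfold speed; pose proof (COS_bound th); pose proof (COS_bound M); nra.
  + exists e; split; [lra|]; split; [lra|]; intros t Ht; specialize (Hlt t Ht); lra.
- exists tau; split; [lra|]; split; [rewrite <- Hv; ring | intros; lra].
Qed.

Lemma landing_exists (b q th : R) :
  0 < b -> 0 < q - 2 * b -> q < 1 -> t2 1 b <= th < t3 1 b ->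
  exists e, landing b q th e.
Proof.
intros Hb Hq Hq1 Hth.
destruct (contact_exists b th Hb ltac:(lra) Hth) as [tau Hc].
destruct (rest_exists b q th tau Hb Hq (proj1 Hc) (contact_speed_nonneg b th tau Hc))
  as [e He].
exists e, tau; auto.
Qed.

(** A positive velocity cannot reach zero under a positive resultant force. This excludes the phases
    strictly between t0 and t1, for which [rest_to_free] has no constructor. *)
Lemma landing_force (b q th e : R) :
  0 < q -> landing b q th e -> sin e <= q - 2 * b.
Proof.
intros Hq (tau & Hc & Hle & E & L).
destruct Hle as [Hlt|Heq].
- apply Rnot_lt_le; intros Hpos.
  destruct (cont_gt sin e (q - 2 * b)) as [d [Hd Hdt]];
    [exact (continuity_sin e) | lra |].
  set (y := Rmax tau (e - d / 2)).
  pose proof (Rmax_l tau (e - d / 2)).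
  pose proof (Rmax_r tau (e - d / 2)).
  assert (y < e) by (apply Rmax_lub_lt; lra).
  destruct (mvt (fun t => speed b th t - q * (t - tau)) (fun t => sin t + 2 * b - q) y e)
    as [c [Hcc Ec]]; [|assumption|].
  + intros t; unfold speed; auto_derive; [exact I | ring].
  + assert (q - 2 * b < sin c).
    { apply Hdt; rewrite Rabs_left1 by lra; unfold y in *; lra. }
    specialize (L y ltac:(unfold y in *; lra)); simpl in Ec; nra.
- subst e; replace (q * (tau - tau)) with 0 in E by ring.
  assert (Hf := tangency_force b th tau Hc E); lra.
Qed.

(* The progression started with zero velocity at phase t0. *)
Lemma t0_run (b q : R) :
  admissible b q ->
  0 < t0 1 b q < PI / 2 /\ sin (t0 1 b q) = q - 2 * b /\
  (forall t, t0 1 b q < t <= t1 1 b q ->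
     (q - 2 * b) * (t - t0 1 b q) < cos (t0 1 b q) - cos t) /\
  cos (t0 1 b q) - cos PI < (q - 2 * b) * (PI - t0 1 b q).
Proof.
intros (Hb & Hq & Hq1 & Hch); unfold t1; set (z := t0 1 b q).
pose proof PI_RGT_0.
assert (Hs : sin z = q - 2 * b)
  by (unfold z, t0; replace ((q - 2 * b) / 1) with (q - 2 * b) by field;
      apply sin_asin; lra).
assert (Hz : 0 < z < PI / 2).
{ unfold z, t0 in *; replace ((q - 2 * b) / 1) with (q - 2 * b) in * by field.
  destruct (asin_bound_lt (q - 2 * b) ltac:(lra)).
  split; [|lra]; apply Rnot_le_lt; intros C.
  assert (sin (asin (q - 2 * b)) <= sin 0) by (apply sin_incr_1; lra).
  rewrite sin_0 in *; lra. }
repeat split; try lra.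
- intros t Ht.
  destruct (mvt (fun t => - cos t - (q - 2 * b) * t) (fun t => sin t - (q - 2 * b)) z t)
    as [c [Hc Ec]]; [|lra|].
  + intros r; auto_derive; [exact I | ring].
  + assert (sin z < sin c) by (apply sin_gt_between; lra); simpl in Ec; nra.
- specialize (Hch (PI - z) ltac:(lra)).
  rewrite Rtrigo_facts.cos_pi_minus in Hch; rewrite cos_PI; lra.
Qed.

(** * Trajectories and the switch map *)

(** Trajectories are total functions constrained only on intervals. Each regime is invariant under
    agreement on its interval, so a trajectory can be glued from explicit pieces. *)
Definition agree (w w' : trajectory) (s e : R) : Prop :=
  forall t, s <= t <= e ->
    pos w t = pos w' t /\ vel w t = vel w' t /\ delim w t = delim w' t.

Lemma agree_sub (w w' : trajectory) (s e s' e' : R) :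
  agree w w' s e -> s <= s' -> e' <= e -> agree w w' s' e'.
Proof. intros H H1 H2 t Ht; apply H; lra. Qed.

Lemma motion_agree (f : R -> R) (w w' : trajectory) (s e : R) :
  agree w w' s e -> motion f w s e -> motion f w' s e.
Proof.
intros H (Hp & Hv & Hd); split; [|split].
- apply continuous_on_ext with (pos w); [apply H | exact Hp].
- apply continuous_on_ext with (vel w); [apply H | exact Hv].
- intros t Ht; destruct (Hd t Ht) as [H1 H2].
  rewrite <- (proj1 (proj2 (H t ltac:(lra)))).
  split; [apply is_derive_interior with (pos w) s e
         |apply is_derive_interior with (vel w) s e]; auto; apply H.
Qed.

Lemma free_motion_agree (a b : R) (w w' : trajectory) (s e : R) :
  agree w w' s e -> free_motion a b w s e -> free_motion a b w' s e.
Proof.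
intros H (Hse & Hm & Hd & Hs & Hlt & He); split; [exact Hse|].
split; [apply motion_agree with w; assumption|]; repeat split.
- intros t Ht; destruct (H t Ht) as (_ & _ & <-), (H s ltac:(lra)) as (_ & _ & <-).
  auto.
- destruct (H s ltac:(lra)) as (<- & _ & <-); exact Hs.
- intros t Ht; destruct (H t ltac:(lra)) as (<- & _ & <-); auto.
- destruct (H e ltac:(lra)) as (<- & _ & <-); exact He.
Qed.

Lemma progression_agree (a b q : R) (w w' : trajectory) (s e : R) :
  agree w w' s e -> progression a b q w s e -> progression a b q w' s e.
Proof.
intros H (Hse & Hm & Hd & Hlt & He); split; [exact Hse|].
split; [apply motion_agree with w; assumption|]; repeat split.
- intros t Ht; destruct (H t Ht) as (<- & _ & <-); auto.
- intros t Ht; destruct (H t ltac:(lra)) as (_ & <- & _); auto.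
- destruct (H e ltac:(lra)) as (_ & <- & _); exact He.
Qed.

Lemma stop_agree (w w' : trajectory) (s e : R) :
  agree w w' s e -> stop w s e -> stop w' s e.
Proof.
intros H (Hse & Hs); split; [exact Hse|]; intros t Ht.
destruct (H t Ht) as (<- & <- & <-), (H s ltac:(lra)) as (<- & _ & _); auto.
Qed.

Lemma rest_to_free_le (a b q : R) (w : trajectory) (tau e : R) :
  rest_to_free a b q w tau e -> tau <= e.
Proof.
induction 1 as [|tau e _ _ [H _]|tau s tau' e _ _ [H _] [H' _] _ IH]; lra.
Qed.

Lemma rest_to_free_contact (a b q : R) (w : trajectory) (tau e : R) :
  rest_to_free a b q w tau e -> delim w tau = pos w tau /\ vel w tau = 0.
Proof.
destruct 1 as [tau _ [H1 H2]|tau e _ _ [H1 H2]|tau s tau' e _ _ [H1 H2] _ _];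
  destruct (H2 tau ltac:(lra)) as (_ & E & E'); auto.
Qed.

Lemma rest_to_free_agree (a b q : R) (w w' : trajectory) (tau e : R) :
  agree w w' tau e -> rest_to_free a b q w tau e -> rest_to_free a b q w' tau e.
Proof.
intros H Hr; revert H.
induction Hr as [tau Hp Hst|tau e Hp Hn Hst|tau s tau' e Hp Hn Hst Hpr Hr IH];
  intros H.
- apply rest_free; [exact Hp | apply stop_agree with w; assumption].
- apply rest_stop; [exact Hp | exact Hn | apply stop_agree with w; assumption].
- assert (Hle := rest_to_free_le _ _ _ _ _ _ Hr).
  assert (Hs := proj1 Hst); assert (Hs' := proj1 Hpr).
  apply rest_progression with s tau'; [exact Hp | exact Hn | | |].
  + apply stop_agree with w; [apply agree_sub with tau e; auto; lra | exact Hst].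
  + apply progression_agree with w; [apply agree_sub with tau e; auto; lra | exact Hpr].
  + apply IH; apply agree_sub with tau e; auto; lra.
Qed.

Definition glue (c : R) (w1 w2 : trajectory) : trajectory :=
  let f (g h : R -> R) t := if Rle_dec t c then g t else h t in
  Trajectory (f (pos w1) (pos w2)) (f (vel w1) (vel w2)) (f (delim w1) (delim w2)).

Lemma glue_left (c s e : R) (w1 w2 : trajectory) :
  e <= c -> agree w1 (glue c w1 w2) s e.
Proof.
intros H t Ht; unfold glue; simpl; destruct (Rle_dec t c); [auto | lra].
Qed.

Lemma glue_right (c s e : R) (w1 w2 : trajectory) :
  agree w1 w2 c c -> c <= s -> agree w2 (glue c w1 w2) s e.
Proof.
intros H Hc t Ht; unfold glue; simpl; destruct (Rle_dec t c) as [L|L]; [|auto].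
replace t with c by lra; destruct (H c ltac:(lra)) as (-> & -> & ->); auto.
Qed.

Definition free_trajectory (a b th p : R) : trajectory :=
  Trajectory (fun t => p + a * gap (b / a) th t)
             (fun t => a * speed (b / a) th t)
             (fun _ => p).

Definition progress_vel (a b q s v t : R) : R :=
  v + a * (cos s - cos t) - (q - 2 * b) * (t - s).

Definition progress_trajectory (a b q s y v : R) : trajectory :=
  let x t := y + v * (t - s) + a * (cos s * (t - s) - (sin t - sin s))
             - (q - 2 * b) * (t - s) ^ 2 / 2 in
  Trajectory x (progress_vel a b q s v) x.

Definition rest_trajectory (y : R) : trajectory :=
  Trajectory (fun _ => y) (fun _ => 0) (fun _ => y).

Lemma smooth_motion (f : R -> R) (w : trajectory) (s e : R) :
  (forall t, is_derive (pos w) t (vel w t)) ->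
  (forall t, is_derive (vel w) t (f t)) -> motion f w s e.
Proof.
intros Hp Hv; split; [|split].
- apply continuity_continuous_on, (is_derive_continuity _ _ Hp).
- apply continuity_continuous_on, (is_derive_continuity _ _ Hv).
- auto.
Qed.

Lemma progress_vel_derive (a b q s v t : R) :
  is_derive (progress_vel a b q s v) t (F a b t - q).
Proof. unfold progress_vel, F; auto_derive; [exact I | ring]. Qed.

Lemma free_pos_derive (a b th p t : R) :
  is_derive (pos (free_trajectory a b th p)) t (vel (free_trajectory a b th p) t).
Proof. simpl; unfold gap, speed; auto_derive; [exact I | ring]. Qed.

Lemma free_vel_derive (a b th p t : R) :
  a <> 0 -> is_derive (vel (free_trajectory a b th p)) t (F a b t).
Proof.
intros Ha; simpl; unfold speed, F; auto_derive; [exact I | field; exact Ha].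
Qed.

Lemma progress_pos_derive (a b q s y v t : R) :
  is_derive (pos (progress_trajectory a b q s y v)) t (progress_vel a b q s v t).
Proof.
simpl; unfold progress_vel; auto_derive; [exact I | unfold Rdiv; field].
Qed.

Lemma free_motion_values (a b th tau p : R) (w : trajectory) :
  a <> 0 -> pos w th = p -> vel w th = 0 -> free_motion a b w th tau ->
  forall t, th <= t <= tau ->
    pos w t = p + a * gap (b / a) th t /\ vel w t = a * speed (b / a) th t.
Proof.
intros Ha Ep Ev (Hse & (Hcp & Hcv & Hd) & _).
set (w0 := free_trajectory a b th p).
assert (Hv : forall t, th <= t <= tau -> vel w t = vel w0 t).
{ intros t Ht.
  assert (E := antideriv_unique (vel w) (vel w0) (F a b) th tau Hcv
                 (fun t Ht => proj2 (Hd t Ht)) (fun t => free_vel_derive a b th p t Ha) t Ht).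
  rewrite Ev in E; simpl in E.
  replace (speed (b / a) th th) with 0 in E by (unfold speed; ring).
  simpl; lra. }
intros t Ht; split; [|exact (Hv t Ht)].
assert (E : pos w t - pos w th = pos w0 t - pos w0 th).
{ apply antideriv_unique with (vel w0) tau; [exact Hcp | | | exact Ht].
  - intros r Hr; rewrite <- Hv by lra; apply Hd, Hr.
  - apply free_pos_derive. }
rewrite Ep in E; simpl in E.
replace (gap (b / a) th th) with 0 in E by (unfold gap; ring); lra.
Qed.

Lemma progression_values (a b q s e : R) (w : trajectory) :
  progression a b q w s e ->
  forall t, s <= t <= e -> vel w t = progress_vel a b q s (vel w s) t.
Proof.
intros (Hse & (Hcp & Hcv & Hd) & _) t Ht.
assert (E := antideriv_unique (vel w) (progress_vel a b q s (vel w s))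
               (fun t => F a b t - q) s e Hcv
               (fun t Ht => proj2 (Hd t Ht)) (progress_vel_derive a b q s (vel w s)) t Ht).
replace (progress_vel a b q s (vel w s) s) with (vel w s) in E
  by (unfold progress_vel; ring); lra.
Qed.

Lemma progression_intro (a b q s e y v : R) :
  s < e -> (forall t, s < t < e -> 0 < progress_vel a b q s v t) ->
  progress_vel a b q s v e = 0 ->
  progression a b q (progress_trajectory a b q s y v) s e.
Proof.
intros Hse Hpos He; split; [exact Hse|]; split; [|auto].
apply smooth_motion; [apply progress_pos_derive | apply progress_vel_derive].
Qed.

Lemma next_instant_exists (p s : R) :
  0 <= p < 2 * PI -> exists e, next_instant_of_phase p s e.
Proof.
intros Hp; destruct (phase_decomp s) as (k & Es & Hs).
destruct (Rle_lt_dec (phase s) p) as [L|L].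
- exists (p + 2 * PI * IZR k); split; [lra|]; split.
  + apply phase_eq with k; [exact Hp | reflexivity].
  + intros t Ht; rewrite (phase_eq t k (t - 2 * PI * IZR k)); lra.
- exists (p + 2 * PI * IZR (k + 1)); rewrite plus_IZR; split; [lra|]; split.
  + apply phase_eq with (k + 1)%Z; [exact Hp | rewrite plus_IZR; reflexivity].
  + intros t Ht; destruct (Rlt_le_dec t (2 * PI + 2 * PI * IZR k)).
    * rewrite (phase_eq t k (t - 2 * PI * IZR k)); lra.
    * rewrite (phase_eq t (k + 1) (t - 2 * PI * IZR (k + 1))); rewrite ?plus_IZR; lra.
Qed.

(* The phase at which free motion starts after a contact with zero velocity
   at phase p. *)
Definition release (b p : R) : R :=
  if Rle_dec (t2 1 b) p then if Rlt_dec p (t3 1 b) then p else t2 1 b else t2 1 b.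

Lemma release_in (b p : R) : t2 1 b <= p < t3 1 b -> release b p = p.
Proof. intros H; unfold release; repeat (destruct Rle_dec || destruct Rlt_dec); lra. Qed.

Lemma release_out (b p : R) : ~ (t2 1 b <= p < t3 1 b) -> release b p = t2 1 b.
Proof. intros H; unfold release; repeat (destruct Rle_dec || destruct Rlt_dec); tauto. Qed.

Lemma release_range (b p : R) :
  t2 1 b < t3 1 b -> t2 1 b <= release b p < t3 1 b.
Proof. intros H; unfold release; repeat (destruct Rle_dec || destruct Rlt_dec); lra. Qed.

Lemma t0_scale (a b q : R) : a <> 0 -> t0 a b q = t0 1 (b / a) (q / a).
Proof. intros Ha; unfold t0; f_equal; field; exact Ha. Qed.

Lemma t1_scale (a b q : R) : a <> 0 -> t1 a b q = t1 1 (b / a) (q / a).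
Proof. intros Ha; unfold t1; rewrite t0_scale by exact Ha; reflexivity. Qed.

Lemma t2_scale (a b : R) : a <> 0 -> t2 a b = t2 1 (b / a).
Proof. intros Ha; unfold t2; do 2 f_equal; field; exact Ha. Qed.

Lemma t3_scale (a b : R) : a <> 0 -> t3 a b = t3 1 (b / a).
Proof. intros Ha; unfold t3; do 2 f_equal; field; exact Ha. Qed.

Lemma progress_vel_scale (a b q s v t : R) :
  a <> 0 -> progress_vel a b q s v t =
    v + a * (cos s - cos t - (q / a - 2 * (b / a)) * (t - s)).
Proof. intros Ha; unfold progress_vel; field; exact Ha. Qed.

Lemma progress_vel_speed (a b q th tau t : R) :
  a <> 0 -> progress_vel a b q tau (a * speed (b / a) th tau) t =
    a * (speed (b / a) th t - q / a * (t - tau)).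
Proof. intros Ha; unfold progress_vel, speed; field; exact Ha. Qed.

(** By [t0_run] the velocity is still positive at t1 and would be negative at phase PI. The end thus
    has a phase from which the mass waits for t2, so one such progression suffices. *)
Lemma progression_from_t0 (a b q : R) (w : trajectory) (s e : R) :
  0 < a -> admissible (b / a) (q / a) ->
  progression a b q w s e -> vel w s = 0 -> phase s = t0 a b q ->
  t1 a b q <= phase e < PI.
Proof.
intros Ha Had Hpr Hv Hs.
destruct (t0_run _ _ Had) as (Hz & _ & Hup & Hdown).
pose proof PI_RGT_0.
rewrite t0_scale in Hs by lra; rewrite t1_scale by lra.
set (z := t0 1 (b / a) (q / a)) in *.
assert (Et1 : t1 1 (b / a) (q / a) = PI - z) by reflexivity; rewrite Et1 in *.
destruct (phase_decomp s) as (k & Es & _); rewrite Hs in Es.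
assert (Hval := progression_values a b q s e w Hpr).
destruct Hpr as (Hse & _ & _ & Hpos & He).
assert (Hval' : forall t, s <= t + 2 * PI * IZR k <= e ->
  vel w (t + 2 * PI * IZR k) = a * (cos z - cos t - (q / a - 2 * (b / a)) * (t - z))).
{ intros t Ht; rewrite Hval, Hv, progress_vel_scale by lra.
  rewrite Es, !cos_period_Z; ring. }
assert (Ee : e = e - 2 * PI * IZR k + 2 * PI * IZR k) by ring.
set (u := e - 2 * PI * IZR k) in *.
assert (Hu := Hval' u ltac:(lra)); rewrite <- Ee, He in Hu.
assert (PI - z < u).
{ apply Rnot_le_lt; intros L; specialize (Hup u ltac:(lra)); nra. }
assert (u < PI).
{ apply Rnot_le_lt; intros [L|E].
  - assert (HP := Hval' PI ltac:(lra)).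
    specialize (Hpos (PI + 2 * PI * IZR k) ltac:(lra)); nra.
  - rewrite <- E in Hu; nra. }
rewrite (phase_eq e k u); lra.
Qed.

Lemma rest_to_free_phase (a b q : R) (w : trajectory) (tau e : R) :
  0 < a -> admissible (b / a) (q / a) ->
  rest_to_free a b q w tau e -> phase e = release (b / a) (phase tau).
Proof.
intros Ha Had Hr.
pose proof Had as (Hb & Hq & Hq1 & _).
destruct (t2_t3_bounds (b / a) Hb ltac:(lra)) as (H2 & H3 & _).
assert (Hz : 0 < t0 a b q < PI / 2).
{ rewrite t0_scale by lra; apply t0_run, Had. }
induction Hr as [tau Hp Hst|tau e Hp Hn Hst|tau s tau' e Hp Hn Hst Hpr Hr IH];
  rewrite ?(t2_scale a b), ?(t3_scale a b) in * by lra.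
- rewrite release_in; [reflexivity | exact Hp].
- rewrite release_out by lra; apply Hn.
- assert (Hph : t1 a b q <= phase tau' < PI).
  { apply progression_from_t0 with w s; auto; [|apply Hn].
    destruct Hst as [Hle Hst]; apply (Hst s); lra. }
  rewrite IH, !release_out; lra.
Qed.

(** Uniqueness half of the description of T: regimes integrate explicitly, so the contact and rest
    instants of any trajectory satisfy the normalised equations. *)
Lemma switch_landing (a b q p th th' : R) :
  0 < a -> admissible (b / a) (q / a) ->
  next_switch a b q p th th' ->
  exists e, landing (b / a) (q / a) th e /\ phase th' = release (b / a) (phase e).
Proof.
intros Ha Had (w & tau & Ep & Ed & Ev & Hfree & Hend).
assert (Hval := free_motion_values a b th tau p w ltac:(lra) Ep Ev Hfree).
assert (Hc : first_contact (b / a) th tau).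
{ destruct Hfree as (Hlt & _ & Hdel & _ & Hneg & Hcon); split; [exact Hlt|]; split.
  - rewrite Hdel, Ed, (proj1 (Hval tau ltac:(lra))) in Hcon by lra; nra.
  - intros t Ht; specialize (Hneg t Ht).
    rewrite Hdel, Ed, (proj1 (Hval t ltac:(lra))) in Hneg by lra; nra. }
pose proof (proj1 Hc) as Hlt.
pose proof (proj2 (Hval tau ltac:(lra))) as Evt.
destruct Hend as [[Hv0 Hr]|[Hvpos (tau' & Hpr & Hr)]].
- exists tau; split; [|apply rest_to_free_phase with q w; assumption].
  exists tau; split; [exact Hc|]; split; [lra|]; split; [|intros; lra].
  assert (speed (b / a) th tau = 0) by nra; lra.
- exists tau'; split; [|apply rest_to_free_phase with q w; assumption].
  assert (Hpv := progression_values a b q tau tau' w Hpr).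
  destruct Hpr as (Hlt' & _ & _ & Hpos & He).
  exists tau; split; [exact Hc|]; split; [lra|]; split.
  + rewrite Hpv, Evt, progress_vel_speed in He by lra; nra.
  + intros t Ht; assert (Hvt : 0 < vel w t).
    { destruct (Req_dec t tau) as [->|]; [exact Hvpos | apply Hpos; lra]. }
    rewrite Hpv, Evt, progress_vel_speed in Hvt by lra; nra.
Qed.

Lemma stop_rest_trajectory (y s e : R) : s <= e -> stop (rest_trajectory y) s e.
Proof. intros H; split; [exact H|]; intros t Ht; simpl; auto. Qed.

Lemma rest_to_free_stop_exists (a b q tau y : R) :
  0 <= t2 a b < 2 * PI -> t1 a b q <= phase tau < t2 a b ->
  exists e, rest_to_free a b q (rest_trajectory y) tau e.
Proof.
intros H2 Hp; destruct (next_instant_exists (t2 a b) tau H2) as [e He].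
exists e; apply rest_stop; [exact Hp | exact He|].
apply stop_rest_trajectory, He.
Qed.

Lemma progression_from_t0_exists (a b q s y : R) :
  0 < a -> admissible (b / a) (q / a) -> phase s = t0 a b q ->
  exists e, progression a b q (progress_trajectory a b q s y 0) s e.
Proof.
intros Ha Had Hs.
destruct (t0_run _ _ Had) as (Hz & _ & Hup & Hdown).
pose proof PI_RGT_0.
rewrite t0_scale in Hs by lra.
set (z := t0 1 (b / a) (q / a)) in *.
assert (Et1 : t1 1 (b / a) (q / a) = PI - z) by reflexivity; rewrite Et1 in *.
destruct (phase_decomp s) as (k & Es & _); rewrite Hs in Es.
assert (Hval : forall t, progress_vel a b q s 0 t =
  a * (cos z - cos (t - 2 * PI * IZR k)
       - (q / a - 2 * (b / a)) * (t - 2 * PI * IZR k - z))).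
{ intros t; rewrite progress_vel_scale by lra; rewrite Es, cos_period_Z.
  rewrite <- (cos_period_Z (t - 2 * PI * IZR k) k).
  replace (t - 2 * PI * IZR k + 2 * PI * IZR k) with t by ring; ring. }
set (P := 2 * PI * IZR k) in *.
destruct (first_zero (fun t => - progress_vel a b q s 0 t) (PI - z + P) (PI + P))
  as [e (He & Ee & Hlt)].
- intros t; apply continuity_pt_opp.
  exact (is_derive_continuity _ _ (progress_vel_derive a b q s 0) t).
- lra.
- rewrite Hval; replace (PI - z + P - P) with (PI - z) by ring.
  specialize (Hup (PI - z) ltac:(lra)); nra.
- rewrite Hval; replace (PI + P - P) with PI by ring; nra.
- exists e; apply progression_intro; [lra | | lra].
  intros t Ht; destruct (Rle_lt_dec t (PI - z + P)).
  + rewrite Hval; specialize (Hup (t - P) ltac:(lra)); nra.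
  + specialize (Hlt t ltac:(lra)); lra.
Qed.

Lemma rest_to_free_exists (a b q tau y : R) :
  0 < a -> admissible (b / a) (q / a) -> sin tau <= q / a - 2 * (b / a) ->
  exists w e, pos w tau = y /\ rest_to_free a b q w tau e.
Proof.
intros Ha Had Hsin; pose proof PI_RGT_0.
pose proof Had as (Hb & Hq & Hq1 & _).
destruct (t2_t3_bounds (b / a) Hb ltac:(lra)) as (H2 & H3 & _).
destruct (t0_run _ _ Had) as (Hz & Esz & _ & _).
rewrite <- t0_scale in Hz, Esz by lra.
rewrite <- t2_scale in H2, H3 by lra; rewrite <- t3_scale in H3 by lra.
assert (Et1 : t1 a b q = PI - t0 a b q) by reflexivity.
destruct (phase_decomp tau) as (k & Ek & Hk).
assert (Hph : phase tau <= t0 a b q \/ t1 a b q <= phase tau).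
{ destruct (Rle_lt_dec (phase tau) (t0 a b q)); [auto|].
  right; apply Rnot_lt_le; intros L.
  assert (Hgt : sin (t0 a b q) < sin (phase tau)) by (apply sin_gt_between; lra).
  rewrite Ek, sin_period_Z in Hsin; lra. }
destruct (excluded_middle_informative (t2 a b <= phase tau < t3 a b)) as [Hfree|Hfree].
{ exists (rest_trajectory y), tau; split; [reflexivity|].
  apply rest_free; [exact Hfree | apply stop_rest_trajectory; lra]. }
destruct (excluded_middle_informative (t1 a b q <= phase tau < t2 a b)) as [Hstop|Hstop].
{ destruct (rest_to_free_stop_exists a b q tau y) as [e He]; [lra | exact Hstop|].
  exists (rest_trajectory y), e; auto. }
(* The remaining phases, in [t3, 2 PI) or [0, t0], need three pieces: a wait until phase t0, a
   progression ending between t1 and PI, and a stop until t2. *)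
destruct (next_instant_exists (t0 a b q) tau) as [s Hs]; [lra|].
destruct (progression_from_t0_exists a b q s y Ha Had (proj1 (proj2 Hs))) as [e Hpr].
set (w1 := progress_trajectory a b q s y 0) in *.
assert (Ew1 : pos w1 s = y /\ vel w1 s = 0 /\ delim w1 s = y).
{ unfold w1; simpl; unfold progress_vel; repeat split; field. }
assert (Hpe : t1 a b q <= phase e < PI)
  by (apply progression_from_t0 with w1 s; auto; [apply Ew1 | apply Hs]).
destruct (rest_to_free_stop_exists a b q e (pos w1 e)) as [e' Hr]; [lra | lra|].
set (w2 := rest_trajectory (pos w1 e)) in *.
set (w12 := glue e w1 w2).
assert (Hts : tau <= s) by apply Hs.
assert (Hse : s < e) by apply Hpr.
assert (Hglue12 : agree w1 w2 e e).
{ intros t Ht; replace t with e by lra.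
  destruct Hpr as (_ & _ & Hd & _ & Hv); rewrite <- Hd, Hv by lra; simpl; auto. }
assert (Hglue01 : agree (rest_trajectory y) w12 s s).
{ intros t Ht; replace t with s by lra.
  destruct (glue_left e s s w1 w2 ltac:(lra) s ltac:(lra)) as (E1 & E2 & E3).
  fold w12 in E1, E2, E3; rewrite <- E1, <- E2, <- E3; simpl (pos (rest_trajectory y) s);
  simpl (vel (rest_trajectory y) s); simpl (delim (rest_trajectory y) s).
  destruct Ew1 as (-> & -> & ->); auto. }
exists (glue s (rest_trajectory y) w12), e'; split.
- simpl; destruct Rle_dec; [reflexivity | lra].
- assert (He' := rest_to_free_le _ _ _ _ _ _ Hr).
  apply rest_progression with s e; [lra | exact Hs | | |].
  + apply stop_agree with (rest_trajectory y); [apply glue_left; lra|].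
    apply stop_rest_trajectory; exact Hts.
  + apply progression_agree with w12; [apply glue_right; [exact Hglue01 | lra]|].
    apply progression_agree with w1; [apply glue_left; lra | exact Hpr].
  + apply rest_to_free_agree with w12; [apply glue_right; [exact Hglue01 | lra]|].
    apply rest_to_free_agree with w2; [apply glue_right; [exact Hglue12 | lra]|].
    exact Hr.
Qed.

(** Existence half: flight, progression (absent for a tangential contact) and rest are glued at
    instants where they share position, velocity and delimiter. *)
Lemma landing_switch (a b q p th e : R) :
  0 < a -> admissible (b / a) (q / a) -> landing (b / a) (q / a) th e ->
  exists th', next_switch a b q p th th'.
Proof.
intros Ha Had Hland.
pose proof Had as (Hb & Hq & Hq1 & _).
assert (Hf := landing_force (b / a) (q / a) th e ltac:(lra) Hland).
destruct Hland as (tau & Hc & Hre).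
assert (Hv := contact_speed_nonneg _ _ _ Hc).
set (w0 := free_trajectory a b th p).
assert (Ew0 : pos w0 th = p /\ delim w0 th = p /\ vel w0 th = 0)
  by (unfold w0, free_trajectory, gap, speed; simpl; repeat split; ring).
assert (Hfree : free_motion a b w0 th tau).
{ destruct Hc as (Hlt & E & Hneg); split; [exact Hlt|]; split;
    [apply smooth_motion; intros t;
       [apply free_pos_derive | apply free_vel_derive; lra]|].
  split; [reflexivity|]; split; [apply Ew0|]; split.
  - intros t Ht; specialize (Hneg t Ht); simpl; nra.
  - simpl; rewrite E; ring. }
assert (Hlt : th < tau) by apply Hc.
assert (Ewt : pos w0 tau = p) by (simpl; rewrite (proj1 (proj2 Hc)); ring).
destruct Hre as ([Hle|Heq] & E & Hpos).
- set (v := a * speed (b / a) th tau).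
  set (w1 := progress_trajectory a b q tau p v).
  assert (Hpr : progression a b q w1 tau e).
  { apply progression_intro; [exact Hle | |].
    - intros t Ht; unfold v; rewrite progress_vel_speed by lra.
      specialize (Hpos t ltac:(lra)); nra.
    - unfold v; rewrite progress_vel_speed by lra; rewrite E; ring. }
  destruct (rest_to_free_exists a b q e (pos w1 e) Ha Had Hf) as (w2 & th' & Ew2 & Hr).
  set (w12 := glue e w1 w2).
  assert (Hglue12 : agree w1 w2 e e).
  { intros t Ht; replace t with e by lra.
    destruct (rest_to_free_contact _ _ _ _ _ _ Hr) as [-> ->].
    destruct Hpr as (_ & _ & Hd & _ & Hve); rewrite <- Hd, Hve, Ew2 by lra; auto. }
  assert (Hglue01 : agree w0 w12 tau tau).
  { intros t Ht; replace t with tau by lra.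
    destruct (glue_left e tau tau w1 w2 ltac:(lra) tau ltac:(lra)) as (E1 & E2 & E3).
    fold w12 in E1, E2, E3; rewrite <- E1, <- E2, <- E3, Ewt.
    unfold w1; simpl; unfold progress_vel; fold v.
    repeat split; field. }
  exists th', (glue tau w0 w12), tau.
  destruct (glue_left tau th tau w0 w12 ltac:(lra) th ltac:(lra)) as (F1 & F2 & F3).
  rewrite <- F1, <- F2, <- F3.
  split; [apply Ew0|]; split; [apply Ew0|]; split; [apply Ew0|]; split.
  + apply free_motion_agree with w0; [apply glue_left; lra | exact Hfree].
  + right; split.
    * rewrite <- (proj1 (proj2 (glue_left tau th tau w0 w12 ltac:(lra) tau ltac:(lra)))).
      specialize (Hpos tau ltac:(lra)); simpl.
      replace (tau - tau) with 0 in Hpos by ring; nra.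
    * exists e; split.
      -- apply progression_agree with w12; [apply glue_right; [exact Hglue01 | lra]|].
         apply progression_agree with w1; [apply glue_left; lra | exact Hpr].
      -- apply rest_to_free_agree with w12; [apply glue_right; [exact Hglue01 | lra]|].
         apply rest_to_free_agree with w2; [apply glue_right; [exact Hglue12 | lra]|].
         exact Hr.
- subst e; replace (tau - tau) with 0 in E by ring; rewrite Rmult_0_r in E.
  destruct (rest_to_free_exists a b q tau p Ha Had Hf) as (w2 & th' & Ew2 & Hr).
  assert (Hglue : agree w0 w2 tau tau).
  { intros t Ht; replace t with tau by lra.
    destruct (rest_to_free_contact _ _ _ _ _ _ Hr) as [-> ->].
    rewrite Ewt, Ew2; simpl; rewrite E; repeat split; ring. }
  exists th', (glue tau w0 w2), tau.
  destruct (glue_left tau th tau w0 w2 ltac:(lra) th ltac:(lra)) as (F1 & F2 & F3).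
  rewrite <- F1, <- F2, <- F3.
  split; [apply Ew0|]; split; [apply Ew0|]; split; [apply Ew0|]; split.
  + apply free_motion_agree with w0; [apply glue_left; lra | exact Hfree].
  + left; split.
    * rewrite <- (proj1 (proj2 (glue_left tau th tau w0 w2 ltac:(lra) tau ltac:(lra)))).
      simpl; rewrite E; ring.
    * apply rest_to_free_agree with w2; [apply glue_right; [exact Hglue | lra]|].
      exact Hr.
Qed.

(** The choice is meaningful only where a landing exists, which [landing_exists] gives for th in
    [t2, t3). *)
Definition landing_instant (b q th : R) : R := epsilon (inhabits 0) (landing b q th).

Lemma landing_instant_eq (b q th e : R) :
  landing b q th e -> landing_instant b q th = e.
Proof.
intros H; apply landing_unique with b q th; [|exact H].
unfold landing_instant; apply epsilon_spec; eauto.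
Qed.

Definition switch_map (b q th : R) : R := release b (phase (landing_instant b q th)).

Lemma switch_map_correct (a b q : R) :
  0 < a -> admissible (b / a) (q / a) ->
  is_switch_map a b q (switch_map (b / a) (q / a)).
Proof.
intros Ha Had p tau Htau.
pose proof Had as (Hb & Hq & Hq1 & _).
rewrite t2_scale, t3_scale in Htau by lra.
destruct (landing_exists _ _ _ Hb Hq Hq1 Htau) as [e He].
destruct (phase_decomp tau) as (k & Ek & _).
assert (He' := landing_periodic _ _ _ _ k He); rewrite <- Ek in He'.
split; [exact (landing_switch a b q p tau _ Ha Had He')|].
intros tau' Hn; destruct (switch_landing a b q p tau tau' Ha Had Hn) as (e' & Hl & ->).
rewrite (landing_unique _ _ _ _ _ Hl He'), phase_periodic.
unfold switch_map; rewrite (landing_instant_eq _ _ _ _ He); reflexivity.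
Qed.

(** * Two full branches for small b *)

(* The right-hand side is the integral of 1 - cos over [x - d, x], and 1 - cos is
   the limit of the speed near the first contact as b tends to 0. *)
Lemma sine_lag (al : R) :
  0 < al <= 1 -> exists c, 0 < c /\
  forall x d, al <= x <= 3 * PI / 2 -> 0 <= d <= 12 ->
    c * d <= d - (sin x - sin (x - d)).
Proof.
intros Hal; pose proof PI_RGT_0; pose proof PI2_1.
assert (Hc1 : cos (al / 2) < 1) by (rewrite <- cos_0; apply cos_decreasing_1; lra).
pose proof (COS_bound (al / 2)).
(* For d up to al / 2 the growth rate is at least 1 - cos (al / 2). Afterwards the right-hand side
   does not decrease, and the amount gained, (1 - cos (al / 2)) al / 2, is spread over a length of
   at most 12. *)
exists ((1 - cos (al / 2)) * al / 24); split; [nra|].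
intros x d Hx Hd.
assert (Hder : forall t, is_derive (fun t => t + sin (x - t)) t (1 - cos (x - t))).
{ intros t; auto_derive; [exact I | unfold Rminus; ring]. }
assert (Hsmall : forall t, 0 <= t <= al / 2 ->
          (1 - cos (al / 2)) * t <= t - (sin x - sin (x - t))).
{ intros t Ht; destruct (Req_dec t 0) as [->|].
  - rewrite Rminus_0_r; lra.
  - destruct (mvt _ _ 0 t Hder ltac:(lra)) as [y [Hy Ey]].
    rewrite !Rminus_0_r in Ey.
    assert (Hcos : cos (x - y) <= cos (al / 2)).
    { destruct (Rle_lt_dec (x - y) PI).
      - apply cos_decr_1; lra.
      - assert (0 <= cos (al / 2)) by (apply cos_ge_0; lra).
        assert (cos (x - y) <= 0) by (apply cos_le_0; lra); lra. }
    nra. }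
destruct (Rle_lt_dec d (al / 2)) as [L|L].
- specialize (Hsmall d ltac:(lra)).
  assert (0 <= (1 - cos (al / 2)) * d) by (apply Rmult_le_pos; lra); nra.
- destruct (mvt _ _ (al / 2) d Hder L) as [y [Hy Ey]].
  pose proof (COS_bound (x - y)).
  specialize (Hsmall (al / 2) ltac:(lra)).
  assert (0 <= (1 - cos (x - y)) * (d - al / 2)) by (apply Rmult_le_pos; lra).
  assert (0 <= (1 - cos (al / 2)) * al) by (apply Rmult_le_pos; lra).
  nra.
Qed.

(* al bounds the phases of the relevant contacts from below: contacts with phase
   near 0 have small speed and need not be the first ones. *)
Definition small (b q : R) : Prop :=
  admissible b q /\ 1 / 2 < q /\ 2 * b <= sin (1 / 4) /\ 1000 * b <= 1 /\
  exists al c, 0 < al /\ al + 40 * b <= q * PI - 2 /\ 100 * b < c /\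
    forall x d, al <= x <= 3 * PI / 2 -> 0 <= d <= 12 ->
      c * d <= d - (sin x - sin (x - d)).

Lemma small_exists (th q : R) :
  is_vartheta0 th -> sin th < q < 1 ->
  exists b0, 0 < b0 /\ forall b, 0 < b < b0 -> small b q.
Proof.
intros Hth Hq; pose proof PI_RGT_0; pose proof PI_4; pose proof PI2_1.
(* At PI the chord inequality reads 2 <= PI sin th, whence q PI - 2 > 0, the room for al, and q >
   1/2. *)
assert (Hc := vartheta0_chord th PI Hth ltac:(lra)); rewrite cos_PI in Hc.
destruct (sine_lag ((q * PI - 2) / 2)) as (c & Hc0 & Hlag); [nra|].
assert (Hs : 0 < sin (1 / 4)) by (apply sin_gt_0; lra).
set (l := (sin (1 / 4) / 2 :: 1 / 1000 :: (q * PI - 2) / 80 :: c / 100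
           :: (q - sin th) / 2 :: nil)%list).
exists (fold_right Rmin 1 l); simpl; split.
- repeat apply Rmin_glb_lt; nra.
- intros b [Hb Hlt].
  repeat match type of Hlt with
  | b < Rmin ?x ?y =>
      let H := fresh in
      assert (H : b < x) by (eapply Rlt_le_trans; [exact Hlt | apply Rmin_l]);
      assert (Hlt' : b < y) by (eapply Rlt_le_trans; [exact Hlt | apply Rmin_r]);
      clear Hlt; rename Hlt' into Hlt
  end.
  split; [apply vartheta0_admissible with th; auto; lra|].
  repeat split; try nra.
  exists ((q * PI - 2) / 2), c; repeat split; try nra; exact Hlag.
Qed.

(* The gap at the relevant contact times, between 1/b - 35 and 1/b - 10 after the
   start of the flight, is negative for th = t2 and positive for th = theta_max. *)
Definition theta_max (b : R) : R := PI + acos (1 - 60 * b).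

Definition zone (b th : R) : Prop := t2 1 b <= th <= theta_max b.

(** The condition 2 b <= sin (1/4) puts t2 within 1/4 of PI, hence t3 at least PI / 2 - 1/4 > 5/4
    above 3 PI / 2: a first lower bound for the flight. *)
Lemma zone_facts (b q th : R) :
  small b q -> zone b th ->
  PI < th <= 3 * PI / 2 /\ - 1 <= cos th <= - (1 - 60 * b) /\ sin th <= 0 /\
  th + 5 / 4 <= t3 1 b.
Proof.
intros ((Hb & _) & _ & Hbs & Hb1 & _) [Hlo Hhi]; unfold theta_max in *.
pose proof PI_RGT_0; pose proof PI2_3_2; pose proof PI_4.
destruct (t2_t3_bounds b Hb ltac:(lra)) as (H2 & H3 & Es).
assert (Ec := cos_acos (1 - 60 * b) ltac:(lra)).
assert (Hac := acos_bound (1 - 60 * b)).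
assert (Hac2 : acos (1 - 60 * b) <= PI / 2).
{ apply Rnot_lt_le; intros L.
  assert (cos (acos (1 - 60 * b)) < cos (PI / 2)) by (apply cos_decreasing_1; lra).
  rewrite cos_PI2 in *; lra. }
assert (Hc : cos (acos (1 - 60 * b)) <= cos (th - PI)) by (apply cos_decr_1; lra).
replace (th - PI) with (- (PI - th)) in Hc by ring.
rewrite cos_neg, Rtrigo_facts.cos_pi_minus in Hc.
assert (Ht2 : t2 1 b - PI <= 1 / 4).
{ apply Rnot_lt_le; intros L.
  assert (sin (1 / 4) < sin (t2 1 b - PI)) by (apply sin_increasing_1; lra).
  replace (t2 1 b) with ((t2 1 b - PI) + PI) in Es by ring.
  rewrite neg_sin in Es; lra. }
pose proof (COS_bound th).
assert (sin th <= 0) by (apply sin_le_0; lra).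
repeat split; lra.
Qed.

(** The square of the cosine is 1 - 4 b^2, and a number in [0, 1] is at most its square root. The
    deviation from - 1 is quadratic in b, against 60 b at [theta_max]. *)
Lemma t2_cos (b : R) : 0 < b -> 2 * b < 1 -> cos (t2 1 b) <= - (1 - 4 * b ^ 2).
Proof.
intros Hb Hb1; destruct (t2_t3_bounds b Hb Hb1) as (H2 & _ & Es).
assert (cos (t2 1 b) <= 0) by (apply cos_le_0; lra).
assert (E := sin2_cos2 (t2 1 b)); unfold Rsqr in E; rewrite Es in E; nra.
Qed.

Lemma t2_zone (b q : R) : small b q -> zone b (t2 1 b).
Proof.
intros ((Hb & _) & _ & _ & Hb1 & _); split; [lra|]; unfold theta_max.
pose proof PI_RGT_0.
destruct (t2_t3_bounds b Hb ltac:(lra)) as (H2 & _ & _).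
assert (Hc := t2_cos b Hb ltac:(lra)).
apply Rnot_lt_le; intros L.
assert (Hac := acos_bound (1 - 60 * b)).
assert (Hlt : cos (t2 1 b - PI) < cos (acos (1 - 60 * b)))
  by (apply cos_decreasing_1; lra).
rewrite cos_acos in Hlt by lra.
replace (t2 1 b - PI) with (- (PI - t2 1 b)) in Hlt by ring.
rewrite cos_neg, Rtrigo_facts.cos_pi_minus in Hlt; nra.
Qed.

(** At contact u (- cos th - b u) = sin th - sin tau <= 1, as sin th <= 0. For 5/4 < u < 20 the
    factor is at least 92/100, which is too much. Once u >= 20, b u > 11/10 would give u (cos th + b
    u) > 2. *)
Lemma zone_contact_late (b q th tau : R) :
  small b q -> zone b th -> first_contact b th tau ->
  t3 1 b < tau /\ 20 <= tau - th /\ b * (tau - th) <= 11 / 10.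
Proof.
intros Hsm Hz (Hlt & E & _).
destruct (zone_facts b q th Hsm Hz) as (Hth & Hcos & Hsin & H3).
destruct Hsm as ((Hb & _) & _ & _ & Hb1 & _).
assert (Htau : t3 1 b < tau).
{ apply Rnot_le_lt; intros L.
  destruct (speed_gap_neg b th tau Hb ltac:(lra) (proj1 Hz)); lra. }
split; [exact Htau|]; unfold gap in E.
pose proof (SIN_bound th); pose proof (SIN_bound tau).
set (u := tau - th) in *; assert (5 / 4 < u) by (unfold u; lra).
assert (Hu : 20 <= u).
{ apply Rnot_lt_le; intros L.
  assert (b * u <= 20 * b) by nra.
  assert (u * (- cos th - b * u) <= 1) by nra.
  assert (92 / 100 <= - cos th - b * u) by lra.
  nra. }
split; [exact Hu|]; apply Rnot_lt_le; intros L; nra.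
Qed.

(* Raising th adds the constant D to the speed, hence at least D (tau' - th') to the
   gap, so the contact comes earlier by more than D / q, as the flight is long: this
   outweighs the gain D in speed during the progression. *)
Lemma landing_decr (b q th th' e e' : R) :
  small b q -> zone b th -> zone b th' -> th < th' ->
  landing b q th e -> landing b q th' e' -> e' < e.
Proof.
intros Hsm Hz Hz' Hlt (tau & Hc & Hle & E & Hpos) (tau' & Hc' & Hle' & E' & Hpos').
destruct (zone_contact_late b q th tau Hsm Hz Hc) as (Htau3 & Hu & Hbu).
destruct (zone_contact_late b q th' tau' Hsm Hz' Hc') as (Htau3' & Hu' & _).
destruct (zone_facts b q th Hsm Hz) as (Hth & Hcos & _ & _).
destruct (zone_facts b q th' Hsm Hz') as (_ & _ & _ & H3').
destruct Hsm as ((Hb & _) & Hq & _ & Hb1 & _).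
set (D := cos th' - cos th - 2 * b * (th' - th)).
assert (HD : 0 < D).
{ destruct (mvt (fun t => cos t - 2 * b * t) (fun t => - (sin t + 2 * b)) th th')
    as [c [Hcc Ec]]; [|exact Hlt|].
  - intros t; auto_derive; [exact I | ring].
  - assert (Hf := force_neg b c Hb ltac:(lra) ltac:(destruct Hz; lra)).
    unfold D; simpl in Ec; nra. }
assert (Espeed : forall t, speed b th' t = speed b th t + D)
  by (intros t; unfold speed, D; ring).
assert (Egap : forall t, gap b th t = gap b th' t - D * (t - th') + gap b th th')
  by (intros t; unfold gap, D; ring).
assert (Hneg : gap b th th' < 0)
  by (apply speed_gap_neg; [exact Hb | lra | apply Hz | lra]).
assert (Htau : tau' < tau).
{ apply Rnot_le_lt; intros L.
  assert (gap b th' tau <= 0).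
  { destruct Hc' as (_ & E0 & Hn); destruct L as [L| ->]; [|lra].
    left; apply Hn; lra. }
  assert (E0 := Egap tau); rewrite (proj1 (proj2 Hc)) in E0; nra. }
destruct (mvt _ _ tau' tau (gap_derive b th) Htau) as [c [Hcc Ec]].
rewrite (proj1 (proj2 Hc)), (Egap tau'), (proj1 (proj2 Hc')) in Ec.
assert (Hv : speed b th c <= 5).
{ unfold speed; pose proof (COS_bound c).
  assert (b * (c - th) <= b * (tau - th)) by nra; lra. }
(* The flight from th' lasts at least 20 and the speed is at most 5, so tau - tau' >= 4 D, more than
   D / q because q > 1/2. *)
assert (HDq : D < q * (tau - tau')) by nra.
apply Rnot_le_lt; intros L.
assert (H : q * (e - tau') <= speed b th' e).
{ destruct L as [L| ->]; [left; apply Hpos'; lra | lra]. }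
rewrite Espeed, E in H; nra.
Qed.

(** The velocity at phase x of a progression that comes to rest at phase z is the difference of the
    two sides, so the progression does not end before z. Up to PI this is the chord inequality;
    beyond, the resultant force is negative. *)
Lemma hill_top (b q x z : R) :
  admissible b q -> 0 <= x < z -> PI < z <= 3 * PI / 2 ->
  cos x + (q - 2 * b) * x < cos z + (q - 2 * b) * z.
Proof.
intros (Hb & Hq & Hq1 & Hch) Hx Hz; pose proof PI_RGT_0.
destruct (Rlt_le_dec x PI) as [L|L].
- specialize (Hch (PI - x) ltac:(lra)); rewrite Rtrigo_facts.cos_pi_minus in Hch.
  pose proof (COS_bound z); nra.
- destruct (mvt (fun t => cos t + (q - 2 * b) * t) (fun t => (q - 2 * b) - sin t) x z)
    as [c [Hc Ec]]; [|lra|].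
  + intros t; auto_derive; [exact I | ring].
  + assert (sin c <= 0) by (apply sin_le_0; lra); simpl in Ec; nra.
Qed.

(* The condition that the progression ends at e gives the contact instant tau as a
   function of th; it remains to solve gap b th (tau th) = 0 for th. *)
Lemma landing_onto (b q : R) (k : Z) (z : R) :
  small b q -> / b - 12 - 4 * PI < 2 * PI * IZR k <= / b - 12 ->
  t2 1 b <= z <= 3 * PI / 2 ->
  exists th, zone b th /\ landing b q th (z + 2 * PI * IZR k).
Proof.
intros Hsm Hk Hz.
assert (Hzone := zone_facts b q).
assert (Hz2 := t2_zone b q Hsm).
pose proof Hsm as (Had & Hq & _ & Hb1 & al & c & Hal & Hal40 & Hc & Hlag).
pose proof Had as (Hb & Hqb & Hq1 & _).
pose proof PI_RGT_0; pose proof PI_4; pose proof PI2_3_2.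
destruct (t2_t3_bounds b Hb ltac:(lra)) as (H2 & H3 & _).
set (P := 2 * PI * IZR k) in *; set (e := z + P).
assert (Hbi : b * / b = 1) by (apply Rinv_r; lra).
assert (Hib : 1000 <= / b) by (apply Rmult_le_reg_l with b; lra).
assert (Hbmul : forall x y, x <= y -> b * x <= b * y)
  by (intros x y Hxy; apply Rmult_le_compat_l; lra).
assert (Hcz : - 1 <= cos z <= 0) by (pose proof (COS_bound z); split; [lra | apply cos_le_0; lra]).
assert (Ece : cos e = cos z) by apply cos_period_Z.
set (tau := fun th => e - speed b th e / q).
assert (Htau : forall th, zone b th ->
          0 < e - tau th /\ q * (e - tau th) = speed b th e /\
          speed b th e <= 1 - cos z + 40 * b /\
          / b - 35 <= tau th - th <= / b - 10).
{ intros th Hth; destruct (Hzone th Hsm Hth) as (Ht & Hcos & _ & _).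
  (* Both z and th lie in (PI, 3 PI / 2], so e - th is within 2 of P, and 12 + 4 PI + 2 <= 30. Hence
     2 b (e - th) is 2 and the speed at e is 1 - cos z, both up to O(b); division by q > 1/2 gives e
     - tau < 5. *)
  assert (Hu : / b - 30 <= e - th <= / b - 10) by (unfold e; lra).
  assert (Hbl := Hbmul _ _ (proj1 Hu)); assert (Hbh := Hbmul _ _ (proj2 Hu)).
  assert (Hv : 9 / 10 <= speed b th e <= 1 - cos z + 40 * b)
    by (unfold speed; rewrite Ece; lra).
  assert (Eq : q * (e - tau th) = speed b th e) by (unfold tau; field; lra).
  assert (0 < e - tau th < 5) by (split; apply Rmult_lt_reg_l with q; lra).
  repeat split; lra. }
assert (Hphi : continuity (fun th => gap b th (tau th))).
{ intros th; apply derivable_continuous_pt, ex_derive_Reals_0.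
  unfold gap, tau, speed; auto_derive; auto. }
destruct (ivt_on (fun th => gap b th (tau th)) (t2 1 b) (theta_max b) 0)
  as [th [Hth Eth]].
- apply continuity_continuous_on, Hphi.
- apply Hz2.
- assert (Hmax : zone b (theta_max b)) by (split; [apply Hz2 | lra]).
  assert (gap b (t2 1 b) (tau (t2 1 b)) < 0).
  { destruct (Htau _ Hz2) as (_ & _ & _ & Hu).
    destruct (Hzone _ Hsm Hz2) as (_ & _ & Hsin & _).
    assert (Hct := t2_cos b Hb ltac:(lra)).
    pose proof (SIN_bound (tau (t2 1 b))).
    unfold gap; set (u := tau (t2 1 b) - t2 1 b) in *.
    assert (Hbl := Hbmul _ _ (proj1 Hu)); assert (Hbh := Hbmul _ _ (proj2 Hu)).
    assert (b ^ 2 <= b * (1 / 1000)) by (simpl; nra).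
    assert (u * (cos (t2 1 b) + b * u) <= u * (- 9 * b))
      by (apply Rmult_le_compat_l; lra).
    lra. }
  assert (0 < gap b (theta_max b) (tau (theta_max b))).
  { destruct (Htau _ Hmax) as (_ & _ & _ & Hu).
    destruct (Hzone _ Hsm Hmax) as (_ & _ & Hsin & _).
    assert (Hct : cos (theta_max b) = - (1 - 60 * b)).
    { unfold theta_max; rewrite Rplus_comm, neg_cos, cos_acos; lra. }
    pose proof (SIN_bound (tau (theta_max b))); pose proof (SIN_bound (theta_max b)).
    unfold gap; set (u := tau (theta_max b) - theta_max b) in *.
    assert (Hbl := Hbmul _ _ (proj1 Hu)); assert (Hbh := Hbmul _ _ (proj2 Hu)).
    assert (u * (25 * b) <= u * (cos (theta_max b) + b * u))
      by (apply Rmult_le_compat_l; lra).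
    lra. }
  nra.
- exists th; split; [exact Hth|]; fold e.
  destruct (Htau th Hth) as (He & Eq & Hv & Hu).
  destruct (Hzone th Hsm Hth) as (Ht & Hcos & Hsin & H5).
  set (s := tau th) in *.
  (* The phase z is at least PI and the speed to be lost at most 2 + 40 b, so q (s - P) >= q PI - 2
     - 40 b >= al. *)
  assert (Hx : al <= s - P).
  { assert (q * (e - s) = q * (z - (s - P))) by (unfold e; ring).
    assert (q * PI <= q * z) by (apply Rmult_le_compat_l; lra).
    assert (al <= q * (s - P)) by lra.
    apply Rnot_lt_le; intros C.
    assert (q * (s - P) < q * al) by (apply Rmult_lt_compat_l; lra).
    assert (q * al <= 1 * al) by (apply Rmult_le_compat_r; lra).
    lra. }
  assert (Hx' : s - P <= 3 * PI / 2) by (unfold e in He; lra).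
  assert (Hbu := Hbmul _ _ (proj1 Hu)).
  exists s; split.
  + split; [lra|]; split; [exact Eth|]; intros t Htt.
    destruct (Rle_lt_dec t (t3 1 b)) as [L3|L3].
    { apply speed_gap_neg; [exact Hb | lra | apply Hth | lra]. }
    destruct (Rle_lt_dec (s - 12) t) as [L|L].
    (* During the last 12 units of time the mean velocity up to s is at least 1 - 82 b plus the sine
       term, and [sine_lag] leaves the margin c - 82 b > 0. *)
    * assert (Hl := Hlag (s - P) (s - t) ltac:(lra) ltac:(lra)).
      replace (s - P - (s - t)) with (t - P) in Hl by ring.
      rewrite <- (sin_period_Z (s - P) k), <- (sin_period_Z (t - P) k) in Hl; fold P in Hl.
      replace (s - P + P) with s in Hl by ring.
      replace (t - P + P) with t in Hl by ring.
      assert (E : gap b th s - gap b th t =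
        (s - t) * (cos th + b * ((s - th) + (t - th))) - (sin s - sin t))
        by (unfold gap; ring).
      assert (Hbt := Hbmul (s - th - 12) (t - th) ltac:(lra)).
      assert ((s - t) * (1 - 82 * b) <= (s - t) * (cos th + b * ((s - th) + (t - th))))
        by (apply Rmult_le_compat_l; lra).
      assert (0 < (s - t) * (c - 82 * b)) by (apply Rmult_lt_0_compat; lra).
      lra.
    (* Contact at s forces b us + cos th <= 3 b, so 12 units earlier the factor is at most - 9 b. If
       b u > 1/8 the product is below - 9/8, otherwise below - (5/4)(81/100); both are below - 1,
       the least value that the sine terms, at most 1, allow. *)
    * unfold gap in *; pose proof (SIN_bound s); pose proof (SIN_bound t).
      pose proof (SIN_bound th).
      set (u := t - th) in *; set (us := s - th) in *.
      assert (5 / 4 < u <= us - 12) by (unfold u, us; lra).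
      assert (Hus : us * (b * us + cos th) <= 2) by lra.
      assert (b * us + cos th <= 3 * b).
      { apply Rnot_lt_le; intros C.
        assert (us * (3 * b) <= us * (b * us + cos th)) by (apply Rmult_le_compat_l; lra).
        lra. }
      assert (Hbt := Hbmul u (us - 12) ltac:(lra)).
      destruct (Rle_lt_dec (b * u) (1 / 8)).
      -- assert (u * (b * u + cos th) <= u * (- 81 / 100)) by (apply Rmult_le_compat_l; lra).
         lra.
      -- assert (u * (b * u + cos th) <= u * (- 9 * b)) by (apply Rmult_le_compat_l; lra).
         lra.
  + split; [lra|]; split; [lra|]; intros t Htt.
    (* The contact phase is at least al > 0, so [hill_top] covers the whole progression. *)
    assert (Hh := hill_top b q (t - P) z Had ltac:(unfold e in *; lra) ltac:(lra)).
    rewrite <- (cos_period_Z (t - P) k) in Hh; fold P in Hh.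
    replace (t - P + P) with t in Hh by ring.
    unfold speed in *; rewrite Ece in Eq; unfold e in Eq |- *; nra.
Qed.

Lemma zone_landing (b q th : R) :
  small b q -> zone b th -> landing b q th (landing_instant b q th).
Proof.
intros Hsm Hz; destruct (zone_facts b q th Hsm Hz) as (_ & _ & _ & H3).
destruct Hsm as ((Hb & Hq & Hq1 & _) & _).
destruct (landing_exists b q th Hb Hq Hq1) as [e He]; [destruct Hz; lra|].
rewrite (landing_instant_eq b q th e He); exact He.
Qed.

Lemma switch_map_window (b q th e : R) (k : Z) :
  small b q -> landing b q th e ->
  t2 1 b + 2 * PI * IZR k <= e <= 3 * PI / 2 + 2 * PI * IZR k ->
  switch_map b q th = e - 2 * PI * IZR k.
Proof.
intros Hsm Hl He; pose proof PI_RGT_0.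
pose proof Hsm as ((Hb & _) & _ & _ & Hb1 & _).
destruct (t2_t3_bounds b Hb ltac:(lra)) as (H2 & H3 & _).
unfold switch_map; rewrite (landing_instant_eq b q th e Hl).
rewrite (phase_eq e k (e - 2 * PI * IZR k)) by lra.
apply release_in; lra.
Qed.

(** From 3 PI / 2 the landing phase first runs up to t3, where release is immediate, and then on to
    the next t2, where release waits for t2. *)
Lemma switch_map_gap (b q th e : R) (k : Z) :
  small b q -> landing b q th e ->
  3 * PI / 2 + 2 * PI * IZR (k - 1) <= e <= t2 1 b + 2 * PI * IZR k ->
  switch_map b q th = t2 1 b \/ 3 * PI / 2 <= switch_map b q th.
Proof.
intros Hsm Hl He; pose proof PI_RGT_0.
pose proof Hsm as ((Hb & _) & _ & _ & Hb1 & _).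
destruct (t2_t3_bounds b Hb ltac:(lra)) as (H2 & H3 & _).
unfold switch_map; rewrite (landing_instant_eq b q th e Hl).
assert (Hk : 2 * PI * IZR (k - 1) = 2 * PI * IZR k - 2 * PI)
  by (rewrite minus_IZR; ring).
destruct (Rlt_le_dec e (2 * PI * IZR k)).
- rewrite (phase_eq e (k - 1) (e - 2 * PI * IZR (k - 1))) by lra.
  destruct (Rlt_le_dec (e - 2 * PI * IZR (k - 1)) (t3 1 b)).
  + rewrite release_in; lra.
  + left; apply release_out; lra.
- rewrite (phase_eq e k (e - 2 * PI * IZR k)) by lra; left.
  destruct (Req_dec (e - 2 * PI * IZR k) (t2 1 b)) as [->|].
  + apply release_in; lra.
  + apply release_out; lra.
Qed.

Lemma switch_map_horseshoe (b q : R) :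
  small b q ->
  exists lo hi : bool -> R,
    horseshoe (switch_map b q) lo hi (t2 1 b) (3 * PI / 2) /\
    switch_map b q (hi true) = t2 1 b /\
    switch_map b q (lo false) = 3 * PI / 2 /\
    (forall th, hi true <= th <= lo false ->
       switch_map b q th = t2 1 b \/ 3 * PI / 2 <= switch_map b q th).
Proof.
intros Hsm; pose proof PI_RGT_0.
pose proof Hsm as ((Hb & _) & _ & _ & Hb1 & _).
destruct (t2_t3_bounds b Hb ltac:(lra)) as (H2 & H3 & _).
set (y := (/ b - 12) / (2 * PI)).
assert (Ey : / b - 12 = 2 * PI * y) by (unfold y; field; lra).
destruct (base_Int_part y) as [Hk1 Hk2]; set (k := Int_part y) in *.
(* As k is the integer part of y, both k and k - 1 meet the bounds of [landing_onto], whose slack 4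
   PI is two periods. The later window belongs to [true], the left segment, since landing decreases
   in th. *)
pose (win := fun i : bool => if i then k else (k - 1)%Z).
assert (Hwin : forall i, / b - 12 - 4 * PI < 2 * PI * IZR (win i) <= / b - 12).
{ intros [|]; unfold win; rewrite ?minus_IZR, Ey; nra. }
assert (Hwtf : 2 * PI * IZR (win false) = 2 * PI * IZR (win true) - 2 * PI)
  by (unfold win; rewrite minus_IZR; ring).
assert (Hdecr : forall th th' e e', zone b th -> zone b th' ->
          landing b q th e -> landing b q th' e' -> e < e' -> th' < th).
{ intros th th' e e' Hz Hz' Hl Hl' Hlt; apply Rnot_le_lt; intros [L|E].
  - specialize (landing_decr b q th th' e e' Hsm Hz Hz' L Hl Hl'); lra.
  - subst th'; rewrite (landing_unique b q th e e' Hl Hl') in Hlt; lra. }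
assert (Hdecr' : forall th th' e e', zone b th -> zone b th' ->
          landing b q th e -> landing b q th' e' -> th <= th' -> e' <= e).
{ intros th th' e e' Hz Hz' Hl Hl' Hle; apply Rnot_lt_le; intros L.
  specialize (Hdecr th th' e e' Hz Hz' Hl Hl' L); lra. }
assert (Hpt : forall i z, t2 1 b <= z <= 3 * PI / 2 ->
          exists th, zone b th /\ landing b q th (z + 2 * PI * IZR (win i)))
  by (intros i z; apply landing_onto; auto).
pose (pt := fun i z => epsilon (inhabits 0)
        (fun th => zone b th /\ landing b q th (z + 2 * PI * IZR (win i)))).
assert (Hpte : forall i z, t2 1 b <= z <= 3 * PI / 2 ->
          zone b (pt i z) /\ landing b q (pt i z) (z + 2 * PI * IZR (win i)))
  by (intros i z Hz; unfold pt; apply epsilon_spec; auto).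
(* The order is reversed: the left endpoint of a segment lands at the right end of its window. *)
pose (lo := fun i => pt i (3 * PI / 2)); pose (hi := fun i => pt i (t2 1 b)).
assert (Hlo : forall i, zone b (lo i) /\
          landing b q (lo i) (3 * PI / 2 + 2 * PI * IZR (win i)))
  by (intros i; apply Hpte; lra).
assert (Hhi : forall i, zone b (hi i) /\
          landing b q (hi i) (t2 1 b + 2 * PI * IZR (win i)))
  by (intros i; apply Hpte; lra).
assert (Hin : forall i th, lo i <= th <= hi i -> exists e, zone b th /\ landing b q th e /\
          t2 1 b + 2 * PI * IZR (win i) <= e <= 3 * PI / 2 + 2 * PI * IZR (win i)).
{ intros i th Hth; destruct (Hlo i) as [Hzl Hll], (Hhi i) as [Hzh Hlh].
  assert (Hz : zone b th) by (destruct Hzl, Hzh; split; lra).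
  assert (Hl := zone_landing b q th Hsm Hz).
  exists (landing_instant b q th); split; [exact Hz|]; split; [exact Hl|]; split.
  - apply (Hdecr' th (hi i)); auto; lra.
  - apply (Hdecr' (lo i) th); auto; lra. }
exists lo, hi; split; [split; [|split; [|split; [|split]]]|split; [|split]].
- intros i; destruct (Hlo i) as [Hzl Hll], (Hhi i) as [Hzh Hlh].
  split; [apply Hzl|]; split.
  + apply (Hdecr (hi i) (lo i) _ _ Hzh Hzl Hlh Hll); lra.
  + apply (zone_facts b q (hi i) Hsm Hzh).
- destruct (Hlo false) as [Hzl Hll], (Hhi true) as [Hzh Hlh].
  apply (Hdecr (lo false) (hi true) _ _ Hzl Hzh Hll Hlh); lra.
- intros i x x' Hx Hxx Hx'.
  destruct (Hin i x ltac:(lra)) as (e & Hz & Hl & He).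
  destruct (Hin i x' ltac:(lra)) as (e' & Hz' & Hl' & He').
  rewrite (switch_map_window b q x e (win i)), (switch_map_window b q x' e' (win i))
    by assumption.
  assert (Hd := landing_decr b q x x' e e' Hsm Hz Hz' Hxx Hl Hl'); lra.
- intros i x Hx; destruct (Hin i x Hx) as (e & _ & Hl & He).
  rewrite (switch_map_window b q x e (win i)) by assumption; lra.
- intros i z Hz; destruct (Hpt i z Hz) as (th & Hzt & Hl).
  exists th; split.
  + destruct (Hlo i) as [Hzl Hll], (Hhi i) as [Hzh Hlh]; split; apply Rnot_lt_le; intros L.
    * assert (Hd := landing_decr b q _ _ _ _ Hsm Hzt Hzl L Hl Hll); lra.
    * assert (Hd := landing_decr b q _ _ _ _ Hsm Hzh Hzt L Hlh Hl); lra.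
  + rewrite (switch_map_window b q th _ (win i) Hsm Hl); lra.
- rewrite (switch_map_window b q _ _ (win true) Hsm (proj2 (Hhi true))); lra.
- rewrite (switch_map_window b q _ _ (win false) Hsm (proj2 (Hlo false))); lra.
- intros th Hth; destruct (Hlo false) as [Hzl Hll], (Hhi true) as [Hzh Hlh].
  assert (Hz : zone b th) by (destruct Hzl, Hzh; split; lra).
  assert (Hl := zone_landing b q th Hsm Hz).
  apply (switch_map_gap b q th _ (win true) Hsm Hl); split.
  + apply (Hdecr' th (lo false)); auto; lra.
  + apply (Hdecr' (hi true) th); auto; lra.
Qed.

Theorem theorem1 :
  forall th0 : R, is_vartheta0 th0 ->
  forall a q : R, 0 < a -> a * sin th0 < q < a ->
  exists b0 : R, 0 < b0 < q / 2 /\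
  forall b : R, 0 < b < b0 ->
  exists T : R -> R,
    (* (1) *)
    (is_switch_map a b q T /\
     (forall theta, t2 a b <= theta < t3 a b ->
        t2 a b <= T theta < t3 a b) /\
     ~ continuous_on (fun theta => t2 a b <= theta < t3 a b) T) /\
    exists lo hi : bool -> R,
      (* (2) *)
      ((forall i, t2 a b <= lo i /\ lo i < hi i /\ hi i <= 3 * PI / 2) /\
       (forall t, ~ (lo false <= t <= hi false /\ lo true <= t <= hi true)) /\
       (forall i z, t2 a b <= z <= 3 * PI / 2 ->
          exists t, lo i <= t <= hi i /\ T t = z) /\
       (forall i, continuous_on (fun t => lo i <= t <= hi i) T)) /\
      (* (3) *)
      (exists P : R -> Prop,
         infinite_set P /\
         (forall p, P p ->
            t2 a b <= p < t3 a b /\ exists n, minimal_period T n p) /\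
         (forall N : nat, exists p n,
            P p /\ minimal_period T n p /\ (N < n)%nat)) /\
      (* (4) *)
      (exists J : R -> Prop,
         Rtopology.compact J /\
         (forall t, J t -> exists i, lo i <= t <= hi i) /\
         (forall t, J t -> J (T t)) /\
         exists H : R -> Sigma,
           continuous_to_Sigma J H /\
           (forall sigma, exists t, J t /\ H t = sigma) /\
           (forall t, J t -> H (T t) = shift (H t))).
Proof.
intros th0 Hth0 a q Ha [Hq1 Hq2]; pose proof PI_RGT_0.
assert (Eq : a * (q / a) = q) by (field; lra).
destruct (small_exists th0 (q / a) Hth0) as (b0 & Hb0 & Hsm).
{ split; apply Rmult_lt_reg_l with a; lra. }
assert (Hsin : 0 < sin th0) by (apply sin_gt_0; destruct Hth0; lra).
assert (Hq0 : 0 < q) by nra.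
(* The factor a undoes the normalisation; q / 4 keeps the bound strictly below q / 2. *)
exists (Rmin (a * b0) (q / 4)); split.
{ split; [apply Rmin_glb_lt; nra|].
  pose proof (Rmin_r (a * b0) (q / 4)); lra. }
intros b Hb; pose proof (Rmin_l (a * b0) (q / 4)).
assert (Eb : a * (b / a) = b) by (field; lra).
assert (Hs : small (b / a) (q / a)).
{ apply Hsm; split; apply Rmult_lt_reg_l with a; lra. }
rewrite (t2_scale a b), (t3_scale a b) by lra.
pose proof Hs as (Had & _ & _ & Hb1 & _).
assert (Hb' : 0 < b / a) by apply Had.
destruct (t2_t3_bounds (b / a) Hb' ltac:(lra)) as (H2 & H3 & _).
destruct (switch_map_horseshoe (b / a) (q / a) Hs) as
  (lo & hi & Hh & Ehi & Elo & Hgap).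
set (T := switch_map (b / a) (q / a)) in *.
pose proof Hh as (Hseg & Hord & _ & _ & Honto).
assert (Hlt := Hseg true); assert (Hlf := Hseg false).
exists T; split; [split; [|split]|exists lo, hi; split; [split; [|split; [|split]]|split]].
- apply switch_map_correct; assumption.
- intros theta _; apply release_range; lra.
- intros Hc.
  assert (Hcs : continuous_on (fun t => hi true <= t <= lo false) T).
  { apply continuous_on_eps; intros x Hx eps He.
    destruct (proj1 (continuous_on_eps _ T) Hc x ltac:(lra) eps He) as [d [Hd H']].
    exists d; split; [exact Hd|]; intros t Ht; apply H'; lra. }
  destruct (ivt_on T (hi true) (lo false) ((t2 1 (b / a) + 3 * PI / 2) / 2) Hcs)
    as [z [Hz Ez]]; [lra | rewrite Ehi, Elo; nra|].
  destruct (Hgap z Hz); lra.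
- exact Hseg.
- intros t Ht; lra.
- exact Honto.
- intros i; apply (horseshoe_continuous T lo hi _ _ i Hh).
- assert (Hper : forall N : nat, exists p n,
            (lo true <= p <= hi true /\ exists n, minimal_period T n p) /\
            minimal_period T n p /\ (N < n)%nat).
  { intros N; destruct (horseshoe_periodic T lo hi _ _ N Hh) as (p & Hp & Hn).
    exists p, (S N); split; [eauto | split; [exact Hn | lia]]. }
  exists (fun p => lo true <= p <= hi true /\ exists n, minimal_period T n p).
  split; [apply unbounded_periods_infinite with T; exact Hper|]; split; [|exact Hper].
  intros p [Hp Hn]; split; [lra | exact Hn].
- exact (horseshoe_semiconjugate T lo hi _ _ Hh).
Qed.
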